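(* Let $W$ be a standard Brownian motion with drift $\mu\in\mathbb{R}$, let $c>0$, and let $S$ be an exponential random variable with density $\nu e^{-\nu x}I_{\{x\ge0\}}$, $\nu>0$, independent of $W$. Then $$\mathbb{E}\left(UTV^c(W,S)\cdot DTV^c(W,S)\right)=\frac{V_\mu(\nu)^2}{2\nu^2}$$ and $$\operatorname{Cov}\left(UTV^c(W,S),DTV^c(W,S)\right)=\frac{V_\mu(\nu)^2}{4\nu^2}=\frac{\mu^2+2\nu}{4\nu^2\left(\sinh\left(c\sqrt{\mu^2+2\nu}\right)\right)^2}>0.$$
   Context: $W_t=B_t+\mu t$, $t\ge0$, with $B$ a standard Brownian motion. With suprema over $n\ge1$ and $0\le t_0<\dots<t_n\le s$: $UTV^c(W,s)=\sup\sum_{i=1}^n\max\{W_{t_i}-W_{t_{i-1}}-c,0\}$ and $DTV^c(W,s)=\sup\sum_{i=1}^n\max\{W_{t_{i-1}}-W_{t_i}-c,0\}$. Further, $V_\mu(\nu)=\dfrac{\sqrt{\mu^2+2\nu}}{\sinh(c\sqrt{\mu^2+2\nu})}$. *)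

(* Defs.v *)
From mathcomp Require Import all_boot all_order all_algebra.
From mathcomp Require Import all_classical all_reals all_analysis.
Import Order.TTheory GRing.Theory Num.Theory.
Import numFieldNormedType.Exports.

Set Implicit Arguments.
Unset Strict Implicit.
Unset Printing Implicit Defensive.

Local Open Scope classical_set_scope.
Local Open Scope ring_scope.

Section truncated_variation.
Context {R : realType}.
Implicit Types (c s : R) (f : R -> R).

(* t 0 < ... < t n in [0, s], with at least two points; the values of t beyond
   index n are irrelevant. *)
Definition is_partition s (n : nat) (t : nat -> R) : Prop :=
  [/\ (1 <= n)%N, 0 <= t 0%N,
      (forall i, (i < n)%N -> t i < t i.+1) & t n <= s].

(* The suprema are taken in R: for continuous f the sets below are bounded
   above. When s <= 0 there is no partition and the supremum is 0. *)
Definition UTV c f s : R :=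
  sup [set v | exists n t, is_partition s n t /\
    v = \sum_(1 <= i < n.+1) Num.max (f (t i) - f (t i.-1) - c) 0].

Definition DTV c f s : R :=
  sup [set v | exists n t, is_partition s n t /\
    v = \sum_(1 <= i < n.+1) Num.max (f (t i.-1) - f (t i) - c) 0].

Definition sinh (x : R) : R := (expR x - expR (- x)) / 2.

Definition V c mu nu : R :=
  Num.sqrt (mu ^+ 2 + 2 * nu) / sinh (c * Num.sqrt (mu ^+ 2 + 2 * nu)).

End truncated_variation.

Section processes.
Context {d : measure_display} {T : measurableType d} {R : realType}.
Variable P : probability T R.

(* Since each A i may be the whole line, the product rule for the full family
   contains the one for every subfamily. *)
Definition mutually_independent (n : nat) (X : 'I_n -> T -> R) : Prop :=
  forall A : 'I_n -> set R, (forall i, measurable (A i)) ->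
    P [set w | forall i, A i (X i w)] = (\prod_(i < n) P (X i @^-1` A i))%E.

(* Processes are families indexed by R of which only the times t >= 0 matter.
   The second parameter of normal_prob is the standard deviation. *)
Record standard_brownian_motion (B : R -> T -> R) : Prop := {
  bm_measurable : forall t, 0 <= t -> measurable_fun setT (B t) ;
  bm_start : {ae P, forall w, B 0 w = 0} ;
  bm_independent_increments : forall (n : nat) (t : nat -> R),
    0 <= t 0%N -> (forall i, (i < n)%N -> t i <= t i.+1) ->
    mutually_independent (fun (i : 'I_n) w => B (t i.+1) w - B (t i) w) ;
  bm_gaussian_increments : forall s t, 0 <= s -> s < t ->
    forall A, measurable A ->
      P ((fun w => B t w - B s w) @^-1` A) = normal_prob 0 (Num.sqrt (t - s)) A ;
  bm_continuous : forall w, {within `[0, +oo[, continuous (fun t => B t w)}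
}.

(* W_t = B_t + mu t *)
Definition with_drift (mu : R) (B : R -> T -> R) : R -> T -> R :=
  fun t w => B t w + mu * t.

(* The sigma-algebra generated by the variables X t, t >= 0. *)
Definition sigma_process (X : R -> T -> R) : set (set T) :=
  <<s \bigcup_(t in [set t | 0 <= t]) preimage_set_system setT (X t) measurable >>.

Definition independent_of_process (S : T -> R) (X : R -> T -> R) : Prop :=
  forall E F, sigma_process X E -> preimage_set_system setT S measurable F ->
    P (E `&` F) = (P E * P F)%E.

End processes.

(* Main.v *)
From HB Require Import structures.
Require Import Defs.
From mathcomp Require Import all_boot all_order all_algebra.
From mathcomp Require Import all_classical all_reals all_analysis.
From mathcomp Require Import measurable_realfun zify ring lra.
Import Order.TTheory GRing.Theory Num.Theory.
Import numFieldNormedType.Exports.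

Set Implicit Arguments.
Unset Strict Implicit.
Unset Printing Implicit Defensive.

Local Open Scope classical_set_scope.
Local Open Scope ring_scope.

(** The supremum defining UTV is approached along the dyadic grids of mesh
    h = 2 ^ (- n), on which everything can be computed. Along a grid, the best
    sum of excesses over c is produced by a greedy rule: follow the walk
    obtained by pushing the increments xi_0, xi_1, ... back into [0, c] and
    add up the amounts u_k cut off at the upper end c ([gridsum_le],
    [gridsum_attain]). Since a finer grid only helps and the path is
    continuous, these totals increase to UTV ([UTV_ereal_sup]). As DTV of a path
    is UTV of the opposite path, DTV is obtained in the same way from the
    increments - xi_k, with amounts v_k. Write U_N and D_N for the two totals
    after N steps.

    The factor 2 in E(UTV * DTV) = 2 E(UTV) E(DTV) is a renewal effect which is
    exact on every grid. The walks driven by xi and by - xi, both started at 0,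
    have positions whose sum never exceeds c ([walk_oppD]). Hence u_k > 0 puts
    the first walk at c and the second one back at its starting point 0, so
    that the v_l with l > k are independent of u_k and distributed as if time
    started afresh; moreover u_k v_k = 0. The number of grid steps before S is
    geometric, P(N > k) = rho ^ (k + 1) with rho = exp(- nu h), and therefore
    E(U_N D_N) = 2 E(U_N) E(D_N) by a Cauchy product ([mean_ups_product]).

    The means follow from a martingale. With
    delta = sqrt(m ^ 2 + 2 nu), p = delta - m and q = delta + m, a Gaussian
    increment of drift m over a time h satisfies E exp(p xi) = E exp(- q xi) =
    1 / rho. Hence for f(z) = A exp(p z) + B exp(- q z) the discounted values of
    f along the walk only change in mean through the overshoots of [0, c]
    ([sum_mean_overshoot]). Choosing f with f'(0) = 0 and f'(c) = 1, the
    overshoots are u_k up to second order; convexity of f gives the upper bound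
    E(U_N) <= f(0) ([mean_ups_le]), and a fourth moment estimate for the
    increments gives the converse in the limit h -> 0 ([mean_ups_ge],
    [grid_mean_cvg]). Here f(0) = exp(m c) V / (2 nu), and the exponential
    factors of m = mu and m = - mu cancel in E(UTV) E(DTV) = V ^ 2 / (4 nu ^ 2). *)

(* Splits every minimum and maximum in the goal and closes the linear cases. *)
Ltac minmax := rewrite /Num.max /Num.min /Order.max /Order.min;
  repeat match goal with
  | |- context [if (?a < ?b)%R then _ else _] => case: (ltP a b) end;
  move=> *; lra.

(** * The walk reflected in [0, c] and truncated variation of sequences *)

Section reflected_walk.
Context {R : realType}.
Implicit Types (c : R) (x w : nat -> R).

Definition clip c (y : R) : R := Num.max 0 (Num.min c y).
Definition excess c (y : R) : R := Num.max (y - c) 0.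
Definition deficit (y : R) : R := Num.max (- y) 0.

(** Two-sided Skorokhod reflection in [0, c], started at 0, of the partial sums
    of the increments [x]. *)
Fixpoint walk c x (k : nat) : R :=
  if k is k'.+1 then clip c (walk c x k' + x k') else 0.

Definition up c x k : R := excess c (walk c x k + x k).

Lemma excess_ge0 c y : 0 <= excess c y.
Proof. by rewrite /excess le_max lexx orbT. Qed.

Lemma deficit_ge0 (y : R) : 0 <= deficit y.
Proof. by rewrite /deficit le_max lexx orbT. Qed.

Lemma clip_ge0 c y : 0 <= clip c y.
Proof. by rewrite /clip le_max lexx. Qed.

Lemma clip_le c y : 0 <= c -> clip c y <= c.
Proof. by move=> c0; rewrite /clip ge_max c0 ge_min lexx. Qed.

Lemma clipE c y : 0 <= c -> clip c y = y - excess c y + deficit y.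
Proof.
by move=> c0; rewrite /clip /excess /deficit; minmax.
Qed.

Lemma walk_ge0 c x k : 0 <= walk c x k.
Proof. by case: k => //= k; exact: clip_ge0. Qed.

Lemma walk_le c x k : 0 <= c -> walk c x k <= c.
Proof. by move=> c0; case: k => //= k; exact: clip_le. Qed.

Lemma up_ge0 c x k : 0 <= up c x k.
Proof. exact: excess_ge0. Qed.

(** The walk of [- x], seen from the end c, is the walk of [x] started at c
    instead of 0; clipping preserves the order of the two. *)
Lemma walk_oppD c x k : 0 <= c -> walk c x k + walk c (\- x) k <= c.
Proof.
move=> c0; elim: k => [|k IH] /=; first by rewrite addr0.
move: (walk_ge0 c x k) (walk_ge0 c (\- x) k) IH.
set a := walk c x k; set b := walk c _ k => a0 b0 IH.
by rewrite /clip; move: a0 b0 IH; minmax.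
Qed.

(** Renewal: an overshoot at c leaves the walk of [x] at c, hence the walk of
    [- x] at its starting point. *)
Lemma up_gt0_walk c x k : 0 <= c -> 0 < up c x k -> walk c (\- x) k.+1 = 0.
Proof.
move=> c0 u0; have := walk_oppD x k.+1 c0; have := walk_ge0 c (\- x) k.+1.
have -> : walk c x k.+1 = c.
  by move: c0 u0; rewrite /up /excess /= /clip; minmax.
by lra.
Qed.

Lemma up_opp_eq0 c x k : 0 < c -> up c x k * up c (\- x) k = 0.
Proof.
move=> c0; have [u0|] := ltP 0 (up c x k); last first.
  move=> u0; have -> : up c x k = 0 by have := up_ge0 c x k; lra.
  by rewrite mul0r.
suff -> : up c (\- x) k = 0 by rewrite mulr0.
have := walk_oppD x k (ltW c0).
by move: c0 u0; rewrite /up /excess /=; minmax.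
Qed.

(** The walk stays in an interval of length c and its pushes at 0 are upward, so
    a rise of [w] beyond c has to be cut off at the upper end. *)
Lemma sum_up_ge c w (xi := fun k => w k.+1 - w k) (j k : nat) :
  0 <= c -> (j <= k)%N ->
  excess c (w k - w j) <= \sum_(j <= i < k) up c xi i.
Proof.
move=> c0 jk; rewrite /excess ge_max; apply/andP; split; last first.
  by rewrite sumr_ge0// => i _; exact: up_ge0.
have step i : walk c xi i.+1 - walk c xi i <= w i.+1 - w i - up c xi i + deficit (walk c xi i + xi i).
  by rewrite /= clipE// /up /xi; lra.
suff : w k - w j - (walk c xi k - walk c xi j) <= \sum_(j <= i < k) up c xi i.
  by have := walk_le xi k c0; have := walk_ge0 c xi j; lra.
rewrite -!(@telescope_sumr _ j k)// -sumrB; apply: ler_sum => i _.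
have /= := clipE (walk c xi i + xi i) c0; rewrite -/(up c xi i) => ->.
by have := deficit_ge0 (walk c xi i + xi i); rewrite /up /xi; lra.
Qed.

Definition gridsum c w (n : nat) (kap : nat -> nat) : R :=
  \sum_(1 <= i < n.+1) excess c (w (kap i) - w (kap i.-1)).

Lemma gridsum_le c w (n N : nat) kap : 0 <= c ->
  (forall i, (i < n)%N -> (kap i <= kap i.+1)%N) -> (kap n <= N)%N ->
  gridsum c w n kap <= \sum_(0 <= i < N) up c (fun k => w k.+1 - w k) i.
Proof.
move=> c0 kapi kapN; apply: (@le_trans _ _
  (\sum_(0 <= i < kap n) up c (fun k => w k.+1 - w k) i)); last first.
  rewrite (@big_cat_nat _ _ _ (kap n) 0 N)//= lerDl.
  by rewrite sumr_ge0// => i _; exact: up_ge0.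
elim: n kapi {kapN N} => [|n IH] kapi.
  by rewrite /gridsum big_geq// sumr_ge0// => i _; exact: up_ge0.
rewrite /gridsum big_nat_recr//= -/(gridsum c w n kap).
rewrite (@big_cat_nat _ _ _ (kap n) 0 (kap n.+1))//=; last exact: kapi.
apply: lerD; first by apply: IH => i ilt; apply: kapi; exact: ltnW.
by apply: sum_up_ge => //; exact: kapi.
Qed.

Lemma gridsum_recr c w n kap m : (kap n < m)%N ->
  gridsum c w n.+1 (fun i => if (i <= n)%N then kap i else m) =
  gridsum c w n kap + excess c (w m - w (kap n)).
Proof.
move=> _; rewrite /gridsum big_nat_recr//=; congr (_ + _).
  apply: eq_big_nat => i /andP[i0 ilt]; rewrite (ilt : (i <= n)%N).
  by rewrite (leq_trans (leq_pred i) (ilt : (i <= n)%N)).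
by rewrite ltnn leqnn.
Qed.

(** The greedy walk is a dynamic programme: [walk c xi k - w k] plus the total cut
    off so far is the best value of a chain whose next rise has already been
    started, its starting value being deducted. The second half carries this
    invariant, which the first half needs at an overshoot. *)
Lemma gridsum_attain c w k (xi := fun k => w k.+1 - w k) : 0 < c ->
  (exists n kap, [/\ forall i, (i < n)%N -> (kap i < kap i.+1)%N, (kap n <= k)%N &
    \sum_(0 <= i < k) up c xi i <= gridsum c w n kap]) /\
  (exists n kap, [/\ forall i, (i < n)%N -> (kap i < kap i.+1)%N, (kap n <= k)%N &
    \sum_(0 <= i < k) up c xi i + walk c xi k - w k
      <= gridsum c w n kap - w (kap n)]).
Proof.
move=> c0; elim: k => [|k [[n [kap [ki kn ks]]] [n' [kap' [ki' kn' ks']]]]].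
  split; exists 0%N, (fun _ => 0%N); split => //; rewrite /gridsum !big_geq//=.
  by lra.
have ext m (la : nat -> nat) : (forall i, (i < m)%N -> (la i < la i.+1)%N) ->
    (la m <= k)%N -> forall i, (i < m.+1)%N ->
    ((if (i <= m)%N then la i else k.+1) < (if (i.+1 <= m)%N then la i.+1 else k.+1))%N.
  move=> li lm i; rewrite ltnS => im; rewrite im; case: ifPn => h; first exact: li.
  by have -> : i = m by apply/eqP; rewrite eqn_leq im leqNgt.
rewrite big_nat_recr//=; set S := \sum_(0 <= i < k) _ in ks ks' *.
have xik : xi k = w k.+1 - w k by [].
split.
  have [h|h] := leP (walk c xi k + xi k) c.
    exists n, kap; split => //; first by rewrite ltnW.
    have -> : up c xi k = 0 by rewrite /up /excess; minmax.
    by rewrite addr0.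
  exists n'.+1, (fun i => if (i <= n')%N then kap' i else k.+1); split.
  - exact: ext.
  - by rewrite ltnn.
  rewrite gridsum_recr//.
  have -> : up c xi k = walk c xi k + xi k - c by rewrite /up /excess; minmax.
  have : w k.+1 - w (kap' n') - c <= excess c (w k.+1 - w (kap' n')).
    by rewrite /excess le_max lexx.
  by lra.
have [h|h] := leP 0 (walk c xi k + xi k).
  exists n', kap'; split => //; first by rewrite ltnW.
  rewrite (clipE _ (ltW c0)).
  have -> : deficit (walk c xi k + xi k) = 0 by rewrite /deficit; minmax.
  rewrite -/(up c xi k); move: ks' xik; rewrite -/S.
  move: (up c xi k) (walk c xi k) (xi k) => a b d ks' xik. lra.
exists n.+1, (fun i => if (i <= n)%N then kap i else k.+1); split.
- exact: ext.
- by rewrite ltnn.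
rewrite gridsum_recr// ltnn.
have -> : up c xi k = 0 by rewrite /up /excess; minmax.
have -> : clip c (walk c xi k + xi k) = 0 by rewrite /clip; minmax.
by have := excess_ge0 c (w k.+1 - w (kap n)); lra.
Qed.

End reflected_walk.

(** * Truncated variation of a continuous path along dyadic grids *)

Section dyadic_grid.
Context {R : realType}.
Implicit Types (c s : R) (f : R -> R).

Definition dyadic (n k : nat) : R := k%:R / 2 ^+ n.

Definition dincr f (n k : nat) : R := f (dyadic n k.+1) - f (dyadic n k).

Definition dUTV c f s (n : nat) : R :=
  \sum_(0 <= i < Num.truncn (s * 2 ^+ n)) up c (dincr f n) i.

Lemma dUTV_nondecreasing c f s n : 0 < c -> dUTV c f s n <= dUTV c f s n.+1.
Proof.
move=> c0; have [[m [kap [kapi kapN le1]]] _] :=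
  gridsum_attain (fun k => f (dyadic n k)) (Num.truncn (s * 2 ^+ n)) c0.
apply: (le_trans le1).
have -> : gridsum c (fun k => f (dyadic n k)) m kap =
    gridsum c (fun k => f (dyadic n.+1 k)) m (fun i => (2 * kap i)%N).
  have e k : dyadic n k = dyadic n.+1 (2 * k)%N.
    by rewrite /dyadic exprS natrM invfM mulrACA divff// mul1r.
  by rewrite /gridsum; apply: eq_bigr => i _; rewrite !e.
apply: gridsum_le; first exact: ltW.
  by move=> i im; rewrite leq_mul2l ltnW ?orbT// kapi.
have [s0|s0] := ltP s 0.
  have t0 k : Num.truncn (s * 2 ^+ k) = 0%N.
    by apply/truncn0Pn; rewrite -ltNge (@le_lt_trans _ _ 0)// ltW// pmulr_llt0// exprn_gt0.
  by move: kapN; rewrite !t0 leqn0 => /eqP ->.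
rewrite truncn_ge_nat; last by rewrite mulr_ge0// exprn_ge0.
rewrite natrM exprS mulrCA ler_pM2l//.
rewrite (@le_trans _ _ (Num.truncn (s * 2 ^+ n))%:R)// ?ler_nat//.
by rewrite truncn_le mulr_ge0// exprn_ge0.
Qed.

Definition UTV_set c f s : set R :=
  [set v | exists n t, is_partition s n t /\
    v = \sum_(1 <= i < n.+1) Num.max (f (t i) - f (t i.-1) - c) 0].

Lemma UTVE c f s : UTV c f s = sup (UTV_set c f s). Proof. by []. Qed.

Lemma UTV_set_le0 c f s : s <= 0 -> UTV_set c f s = set0.
Proof.
move=> s0; rewrite -subset0 => v [n [t [[n1 t0 ti tn] _]]].
have : t 0%N < t n.
  elim: n n1 ti {tn} => // -[_ _|n IH _] ti; first exact: ti.
  by rewrite (@lt_trans _ _ (t n.+1)) ?ti// IH// => i ni; rewrite ti// ltnW.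
by move=> /lt_le_trans/(_ tn); lra.
Qed.

Lemma UTV_set_neq0 c f s : 0 < s -> UTV_set c f s !=set0.
Proof.
move=> s0; eexists; exists 1%N, (fun i => if i is 0%N then 0 else s).
by split; last reflexivity; split => // -[].
Qed.

Lemma dUTV_le c f s n : 0 < c -> 0 < s ->
  exists2 v, UTV_set c f s v & dUTV c f s n <= v.
Proof.
move=> c0 s0; have [[m [kap [kapi kapN le1]]] _] :=
  gridsum_attain (fun k => f (dyadic n k)) (Num.truncn (s * 2 ^+ n)) c0.
have [m0|m0] := posnP m.
  have [v sv] := UTV_set_neq0 c f s0; exists v => //.
  rewrite (@le_trans _ _ 0)//.
    by move: le1; rewrite m0 /gridsum (@big_geq _ _ _ 1 1).
  by move: sv => [k [t [_ ->]]]; rewrite sumr_ge0// => i _; exact: excess_ge0.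
exists (gridsum c (fun k => f (dyadic n k)) m kap) => //.
exists m, (fun i => dyadic n (kap i)); split => //; split => //.
- by rewrite divr_ge0// exprn_ge0.
- by move=> i im; rewrite ltr_pM2r ?ltr_nat ?kapi// invr_gt0 exprn_gt0.
- rewrite ler_pdivrMr ?exprn_gt0//.
  rewrite (@le_trans _ _ (Num.truncn (s * 2 ^+ n))%:R) ?ler_nat//.
  by rewrite truncn_le mulr_ge0 ?exprn_ge0// ltW.
Qed.

Lemma cvg_dyadic (t : R) : 0 <= t ->
  dyadic n (Num.truncn (t * 2 ^+ n)) @[n --> \oo] --> t.
Proof.
move=> t0.
have p2 n : 0 < 2 ^+ n :> R by rewrite exprn_gt0.
have tp n : 0 <= t * 2 ^+ n by rewrite mulr_ge0// ltW.
apply: (squeeze_cvgr (f := fun n => t - (2^-1) ^+ n) (h := fun=> t)).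
- apply: nearW => n; rewrite /dyadic.
  have /andP[h1 h2] := truncn_itv (tp n); apply/andP; split; last first.
    by rewrite ler_pdivrMr.
  rewrite ler_pdivlMr// mulrBl -exprMn mulVf// expr1n lerBlDr.
  by rewrite natr1 ltW.
- rewrite -[X in _ --> X]subr0; apply: cvgB; first exact: cvg_cst.
  by apply: cvg_expr; rewrite ger0_norm ?invr_ge0// invf_lt1// ltr1n.
- exact: cvg_cst.
Qed.

Lemma continuous_excess c : continuous (excess c).
Proof.
move=> y; apply: (@continuous_max _ _ (fun y => y - c : R^o) (cst 0)).
  by apply: cvgB; [exact: cvg_id|exact: cvg_cst].
exact: cvg_cst.
Qed.

(** The times of a partition are rounded down to the grid; continuity makes the
    rounded sums converge. *)
Lemma UTV_set_le_dUTV c f s v M : 0 < c ->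
  {within `[0, +oo[, continuous f} ->
  UTV_set c f s v -> (forall n, dUTV c f s n <= M) -> v <= M.
Proof.
move=> c0 cf [m [t [[m1 t0 ti tm] ->]]] le_M.
have tle i j : (i <= j <= m)%N -> t i <= t j.
  move=> /andP[]; elim: j => [|j IH]; first by rewrite leqn0 => /eqP ->.
  rewrite leq_eqVlt => /orP[/eqP -> //|ij] jm.
  by apply: (le_trans (IH ij (ltnW jm))); apply: ltW; exact: ti.
have tge0 i : (i <= m)%N -> 0 <= t i.
  by move=> im; rewrite (le_trans t0)// tle.
have s0 : 0 <= s by rewrite (le_trans _ tm)// tge0.
pose kap n i := Num.truncn (t i * 2 ^+ n).
have le_n n : gridsum c (fun k => f (dyadic n k)) m (kap n) <= M.
  apply: le_trans (le_M n); apply: gridsum_le; first exact: ltW.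
    by move=> i im; apply: le_truncn; rewrite ler_pM2r ?exprn_gt0// ltW// ti.
  by apply: le_truncn; rewrite ler_pM2r ?exprn_gt0.
have cvgf i : (i <= m)%N -> f (dyadic n (kap n i)) @[n --> \oo] --> f (t i).
  move=> im; have /subspace_continuousP/(_ (t i)) := cf.
  rewrite /= in_itv/= tge0// => /(_ isT) cfi.
  apply: cvg_comp cfi => A [e /= e0 eA].
  have /cvgrPdist_lt/(_ e e0) := cvg_dyadic (tge0 i im).
  apply: filterS => n ne; apply: eA => //=.
  by rewrite in_itv/= andbT /dyadic divr_ge0 ?exprn_ge0.
have : gridsum c (fun k => f (dyadic n k)) m (kap n) @[n --> \oo] -->
    \sum_(1 <= i < m.+1) excess c (f (t i) - f (t i.-1)).
  rewrite /gridsum big_nat.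
  under eq_cvg do rewrite big_nat.
  apply: cvg_big => [|i /andP[i1 im]]; first exact: add_continuous.
  apply: continuous_cvg; first exact: continuous_excess.
  by apply: cvgB; apply: cvgf => //; rewrite (leq_trans (leq_pred _)).
by move=> /cvgr_to_le; apply; apply: nearW => n; exact: le_n.
Qed.

(** The identity also holds for an unbounded set of sums: both sides are then 0
    by the conventions for [sup] and [fine]. *)
Lemma UTV_ereal_sup c f s : 0 < c -> {within `[0, +oo[, continuous f} ->
  UTV c f s = fine (ereal_sup (range (fun n => (dUTV c f s n)%:E))).
Proof.
move=> c0 cf; rewrite UTVE; have [s0|s0] := leP s 0.
  rewrite UTV_set_le0// sup0.
  have -> : range (fun n => (dUTV c f s n)%:E) = [set 0%E].
    apply/seteqP; split => [_ [n _ <-]|_ ->] /=; last exists 0%N => //;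
      rewrite /dUTV (_ : Num.truncn _ = 0%N) ?big_geq//; apply/truncn0Pn;
      rewrite -ltNge (@le_lt_trans _ _ 0)// mulr_le0_ge0// exprn_ge0//.
  by rewrite ereal_sup1.
have E0 := UTV_set_neq0 c f s0.
have -> : ereal_sup (range (fun n => (dUTV c f s n)%:E)) =
    ereal_sup (EFin @` UTV_set c f s).
  apply/eqP; rewrite eq_le; apply/andP; split; apply: ge_ereal_sup.
    move=> _ [n _ <-]; have [v Ev le_v] := dUTV_le f n c0 s0.
    by apply: le_ereal_sup_tmp; exists v%:E; [exists v|rewrite lee_fin].
  move=> _ [v Ev <-].
  have ub n : ((dUTV c f s n)%:E <= ereal_sup (range (fun n => (dUTV c f s n)%:E)))%E.
    by apply: ereal_sup_ubound; exists n.
  move: ub; case: ereal_sup => [r|_|/(_ 0%N)//]; last by rewrite leey.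
  move=> ub; rewrite lee_fin; apply: (UTV_set_le_dUTV c0 cf Ev) => n.
  by have := ub n; rewrite lee_fin.
have [ubE|nubE] := pselect (has_ubound (UTV_set c f s)).
  by rewrite ereal_sup_EFin.
by rewrite hasNub_ereal_sup// sup_out// => -[].
Qed.

Lemma DTV_UTV c f s : DTV c f s = UTV c (\- f) s.
Proof.
rewrite /DTV /UTV; congr (sup _); apply/seteqP; split => v [n [t [tp ->]]];
  exists n, t; split => //; apply: eq_bigr => i _ /=; congr (Num.max _ _); lra.
Qed.

End dyadic_grid.

(** * Random elements independent of the future *)

Section future_independence.
Context d (T : measurableType d) (R : realType) (P : probability T R).
Variables (S : T -> R) (xi : nat -> T -> R).

(** A pi-system of events depending on the clock [S] and on finitely many of the
    increments from index [k] on. Independence of the past is only ever tested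
    on these events, which avoids generated sigma-algebras. *)
Inductive future : nat -> set T -> Prop :=
| future_clock k C : measurable C -> future k (S @^-1` C)
| future_step k B F : measurable B -> future k.+1 F -> future k (xi k @^-1` B `&` F).

Definition indep_future d' (T' : measurableType d') (k : nat) (H : T -> T') :=
  forall A F, measurable A -> future k F ->
    P (H @^-1` A `&` F) = (P (H @^-1` A) * P F)%E.

Hypothesis mS : measurable_fun setT S.
Hypothesis mxi : forall k, measurable_fun setT (xi k).

Lemma measurable_preimageT d1 (T1 : measurableType d1) (f : T -> T1) A :
  measurable_fun setT f -> measurable A -> measurable (f @^-1` A).
Proof. by move=> mf mA; rewrite -[X in measurable X]setTI; exact: mf. Qed.

Lemma future_measurable k F : future k F -> measurable F.
Proof.
elim=> [k' C mC|k' B F' mB _ mF']; first exact: measurable_preimageT.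
by apply: measurableI => //; exact: measurable_preimageT.
Qed.

Lemma indep_future_comp d1 d2 (T1 : measurableType d1) (T2 : measurableType d2)
    (k : nat) (H : T -> T1) (phi : T1 -> T2) :
  measurable_fun setT phi -> indep_future k H -> indep_future k (phi \o H).
Proof.
move=> mphi iH A F mA FF; rewrite comp_preimage; apply: iH => //.
by rewrite -[X in measurable X]setTI; exact: mphi.
Qed.

Lemma indep_future_cst d1 (T1 : measurableType d1) (k : nat) (a : T1) :
  indep_future k (fun _ : T => a).
Proof.
move=> A F mA FF; rewrite preimage_cst; case: ifPn => _.
  by rewrite setTI probability_setT mul1e.
by rewrite set0I measure0 mul0e.
Qed.

Section product_law.
Context d1 (T1 : measurableType d1) d2 (T2 : measurableType d2).
Variables (H : T -> T1) (X : T -> T2) (m : probability T2 R).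
Hypotheses (mH : measurable_fun setT H) (mX : measurable_fun setT X).
Hypothesis indepHX : forall A B, measurable A -> measurable B ->
  P (H @^-1` A `&` X @^-1` B) = (P (H @^-1` A) * m B)%E.

Let mfunH : {mfun T >-> T1} := HB.pack H (isMeasurableFun.Build _ _ _ _ H mH).

Let mpair : measurable_fun setT (fun w => (H w, X w)).
Proof. exact: measurable_fun_pair. Qed.

Let mfunHX : {mfun T >-> (T1 * T2)%type} :=
  HB.pack (fun w => (H w, X w)) (isMeasurableFun.Build _ _ _ _ _ mpair).

(** Fubini for the joint law of two independent random elements, one of which has
    a prescribed law [m]. *)
Lemma integral_product_law (F : T1 * T2 -> \bar R) :
  measurable_fun setT F -> (forall z, 0 <= F z)%E ->
  (\int[P]_w F (H w, X w) = \int[P]_w \int[m]_x F (H w, x))%E.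
Proof.
move=> mF F0.
transitivity (\int[distribution P mfunHX]_z F z)%E.
  by rewrite ge0_integral_distribution.
transitivity (\int[distribution P mfunH \x m]_z F z)%E.
  apply: eq_measure_integral => A mA _; apply/esym.
  apply: (product_measure_unique (m1 := distribution P mfunH) (m2 := m)) => //.
rewrite fubini_tonelli1// /fubini_F ge0_integral_distribution//.
- exact: measurable_fun_fubini_tonelli_F.
- by move=> y; exact: integral_ge0.
Qed.

End product_law.

Variable gamma : probability R R.
Hypothesis indep_xi : forall k B F, measurable B -> future k.+1 F ->
  P (xi k @^-1` B `&` F) = (gamma B * P F)%E.

Lemma xi_law k B : measurable B -> P (xi k @^-1` B) = gamma B.
Proof.
move=> mB; have := @indep_xi k B (S @^-1` setT) mB (future_clock _ measurableT).
by rewrite preimage_setT setIT probability_setT mule1.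
Qed.

Section step.
Context d1 (T1 : measurableType d1).
Variables (k : nat) (H : T -> T1).
Hypotheses (mH : measurable_fun setT H) (iH : indep_future k H).

Lemma indep_future_xi A B : measurable A -> measurable B ->
  P (H @^-1` A `&` xi k @^-1` B) = (P (H @^-1` A) * gamma B)%E.
Proof.
move=> mA mB; rewrite -(xi_law k mB) -[X in _ `&` X]setIT -(preimage_setT S).
rewrite iH//; last by apply: future_step => //; exact: future_clock.
by rewrite preimage_setT setIT.
Qed.

Lemma indep_future_clock A C : measurable A -> measurable C ->
  P (H @^-1` A `&` S @^-1` C) = (P (H @^-1` A) * P (S @^-1` C))%E.
Proof. by move=> mA mC; rewrite iH//; exact: future_clock. Qed.

Lemma integral_step (F : T1 * R -> \bar R) :
  measurable_fun setT F -> (forall z, 0 <= F z)%E ->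
  (\int[P]_w F (H w, xi k w) = \int[P]_w \int[gamma]_x F (H w, x))%E.
Proof. by apply: integral_product_law => //; exact: indep_future_xi. Qed.

Let mpair : measurable_fun setT (fun w => (H w, xi k w)).
Proof. exact: measurable_fun_pair. Qed.

Let mfunHxi : {mfun T >-> (T1 * R)%type} :=
  HB.pack (fun w => (H w, xi k w)) (isMeasurableFun.Build _ _ _ _ _ mpair).

(** The identity holds on rectangles, which generate the product sigma-algebra, and
    both sides are finite measures of the set [A] of pairs. *)
Lemma indep_future_step : indep_future k.+1 (fun w => (H w, xi k w)).
Proof.
move=> A F mA FF; have mF := future_measurable FF.
have PF : P F = (fine (P F))%:E by rewrite fineK// fin_num_measure.
pose r : {nonneg R} := NngNum (fine_ge0 (measure_ge0 P F)).
pose PFm : {measure set T -> \bar R} := mrestr P mF.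
pose m0 := (pushforward PFm mfunHxi : {measure set (T1 * R)%type -> \bar R}).
pose m1 := m0 mpair.
pose m2 : {measure set (T1 * R)%type -> \bar R} := mscale r (distribution P mfunHxi).
have -> : P ((fun w => (H w, xi k w)) @^-1` A `&` F) = m1 A by [].
rewrite muleC PF; change (m1 A = m2 A).
(* both sides as measures on the product, compared on rectangles *)
pose G : set (set (T1 * R)) := [set X `*` Y | X in measurable & Y in measurable].
apply: (measure_unique G (fun=> setT)) => //.
- by rewrite measurable_prod_measurableType.
- move=> _ _ [X mX [Y mY <-]] [X' mX' [Y' mY' <-]]; rewrite -setXI.
  by exists (X `&` X'); [exact: measurableI|exists (Y `&` Y') => //; exact: measurableI].
- by move=> _; exists setT => //; exists setT => //; rewrite setXTT.
- by apply/seteqP; split => // x _; exists 0%N.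
- move=> _ [X mX [Y mY <-]].
  have -> : m1 (X `*` Y) = P (H @^-1` X `&` (xi k @^-1` Y `&` F)).
    by rewrite setIA.
  have -> : m2 (X `*` Y) = (P F * P (H @^-1` X `&` xi k @^-1` Y))%E.
    by rewrite PF.
  rewrite iH//; last exact: future_step.
  by rewrite indep_future_xi// indep_xi// muleA muleC.
- by move=> _; rewrite /m1 /= /pushforward /= /mrestr setTI (le_lt_trans (probability_le1 _ _))// ltry.
Qed.

End step.

End future_independence.

(** * Cauchy products of nonnegative series *)

Section nonnegative_series.
Local Open Scope ereal_scope.
Context {R : realType}.

Lemma nneseries_trunc (f : nat -> \bar R) N : (forall k, 0 <= f k) ->
  \sum_(k <oo) (if (k < N)%N then f k else 0) = \sum_(0 <= k < N) f k.
Proof.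
move=> f0; rewrite (nneseries_split 0 N); last by move=> k _; case: ifP.
rewrite add0n eseries0 ?adde0; last first.
  by move=> k Nk _; rewrite ltnNge Nk.
by apply: eq_big_nat => k /andP[_ ->].
Qed.

Lemma nneseries_shift (f : nat -> \bar R) N : (forall k, 0 <= f k) ->
  \sum_(k <oo) (if (N <= k)%N then f (k - N)%N else 0) = \sum_(k <oo) f k.
Proof.
move=> f0; rewrite (nneseries_split 0 N); last by move=> k _; case: ifP.
rewrite add0n big_nat big1 ?add0e; last first.
  by move=> k /andP[_ kN]; rewrite leqNgt kN.
rewrite -nneseries_addn; last by move=> k; case: ifP.
by apply: eq_eseriesr => k _; rewrite leq_addl addnK.
Qed.

Lemma nneseries_cauchy_product (a b : nat -> \bar R) :
  (forall k, 0 <= a k) -> (forall k, 0 <= b k) ->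
  (forall k, a k \is a fin_num) -> \sum_(k <oo) b k \is a fin_num ->
  \sum_(k <oo) \sum_(0 <= j < k) a j * b (k - j.+1)%N =
  (\sum_(k <oo) a k) * (\sum_(k <oo) b k).
Proof.
move=> a0 b0 fa fb.
under eq_eseriesr => k _.
  rewrite -(nneseries_trunc (f := fun j => a j * b (k - j.+1)%N)); last first.
    by move=> j; rewrite mule_ge0.
  over.
rewrite nneseries_interchange; last first.
  by move=> i j; case: ifP => // _; rewrite mule_ge0.
rewrite muleC -(fineK fb) -nneseriesZl// fineK//; apply: eq_eseriesr => j _.
rewrite -(fineK (fa j)) muleC -nneseriesZl//.
rewrite -(nneseries_shift (f := fun k => (fine (a j))%:E * b k) j.+1).
  by apply: eq_eseriesr => k _; rewrite fineK.
by move=> k; rewrite fineK// mule_ge0.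
Qed.

End nonnegative_series.

Section measurable_reflection.
Context {R : realType}.
Variable c : R.

Lemma measurable_excess : measurable_fun setT (excess c).
Proof.
rewrite /excess; apply: measurable_maxr => //.
by apply: measurable_funB.
Qed.

Lemma measurable_clip : measurable_fun setT (clip c).
Proof.
rewrite /clip; apply: measurable_maxr => //.
by apply: measurable_minr.
Qed.

End measurable_reflection.

(** * Markov property and renewal for the coupled walks *)

Section coupled_walks.
Context d (T : measurableType d) (R : realType) (P : probability T R).
Variables (S : T -> R) (xi : nat -> T -> R) (gamma : probability R R).
Hypothesis mS : measurable_fun setT S.
Hypothesis mxi : forall k, measurable_fun setT (xi k).
Hypothesis indep_xi : forall k B F, measurable B -> future S xi k.+1 F ->
  P (xi k @^-1` B `&` F) = (gamma B * P F)%E.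
Variable c : R.
Hypothesis c0 : 0 < c.
Implicit Types phi psi : R -> R.

Definition walk_of phi k (w : T) : R := walk c (fun i => phi (xi i w)) k.
Definition up_of phi k (w : T) : R := up c (fun i => phi (xi i w)) k.
Definition ups_of phi k (w : T) : R := \sum_(0 <= i < k) up_of phi i w.

Lemma up_of_ge0 phi k w : 0 <= up_of phi k w. Proof. exact: up_ge0. Qed.

Lemma ups_of_ge0 phi k w : 0 <= ups_of phi k w.
Proof. by apply: sumr_ge0 => i _; exact: up_of_ge0. Qed.

Section state.
Variables (phi psi : R -> R).
Hypotheses (mphi : measurable_fun setT phi) (mpsi : measurable_fun setT psi).

(** The two walks together with their running totals form a Markov chain; the
    overshoots of a step and the earlier totals are functions of its state and of
    the next increment. *)
Definition state k w : (R * R) * (R * R) :=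
  ((walk_of phi k w, walk_of psi k w), (ups_of phi k w, ups_of psi k w)).

Definition next_state (z : ((R * R) * (R * R)) * R) : (R * R) * (R * R) :=
  ((clip c (z.1.1.1 + phi z.2), clip c (z.1.1.2 + psi z.2)),
   (z.1.2.1 + excess c (z.1.1.1 + phi z.2),
    z.1.2.2 + excess c (z.1.1.2 + psi z.2))).

Lemma stateS k w : state k.+1 w = next_state (state k w, xi k w).
Proof. by rewrite /state /next_state /ups_of !big_nat_recr. Qed.

Lemma measurable_projections :
  [/\ measurable_fun setT (fun z : ((R * R) * (R * R)) * R => z.1.1.1),
      measurable_fun setT (fun z : ((R * R) * (R * R)) * R => z.1.1.2),
      measurable_fun setT (fun z : ((R * R) * (R * R)) * R => z.1.2.1),
      measurable_fun setT (fun z : ((R * R) * (R * R)) * R => z.1.2.2) &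
      measurable_fun setT (fun z : ((R * R) * (R * R)) * R => z.2)].
Proof.
by split; repeat (apply: measurable_fst || apply: measurable_snd ||
  apply: (measurableT_comp measurable_fst) || apply: (measurableT_comp measurable_snd)).
Qed.

Lemma measurable_proposals :
  measurable_fun setT (fun z : ((R * R) * (R * R)) * R => z.1.1.1 + phi z.2) /\
  measurable_fun setT (fun z : ((R * R) * (R * R)) * R => z.1.1.2 + psi z.2).
Proof.
have [m1 m2 _ _ m5] := measurable_projections.
by split; apply: measurable_funD => //; exact: measurableT_comp.
Qed.

Lemma measurable_next_state : measurable_fun setT next_state.
Proof.
have [m1 m2 m3 m4 m5] := measurable_projections.
have [p1 p2] := measurable_proposals.
apply: measurable_fun_pair; apply: measurable_fun_pair.
- exact: measurableT_comp (measurable_clip c) p1.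
- exact: measurableT_comp (measurable_clip c) p2.
- by apply: measurable_funD => //; exact: measurableT_comp (measurable_excess c) p1.
- by apply: measurable_funD => //; exact: measurableT_comp (measurable_excess c) p2.
Qed.

Lemma measurable_state k : measurable_fun setT (state k).
Proof.
elim: k => [|k IH].
  have -> : state 0 = cst (0, 0, (0, 0)).
    by apply/funext => w; rewrite /state /ups_of /= !big_geq.
  exact: measurable_cst.
have -> : state k.+1 = next_state \o (fun w => (state k w, xi k w)).
  by apply/funext => w; exact: stateS.
apply: measurableT_comp; first exact: measurable_next_state.
exact: measurable_fun_pair.
Qed.

Lemma indep_future_state k : indep_future P S xi k (state k).
Proof.
elim: k => [|k IH].
  have -> : state 0 = fun=> (0, 0, (0, 0)).
    by apply/funext => w; rewrite /state /ups_of /= !big_geq.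
  exact: indep_future_cst.
have -> : state k.+1 = next_state \o (fun w => (state k w, xi k w)).
  by apply/funext => w; exact: stateS.
apply: indep_future_comp; first exact: measurable_next_state.
by apply: (indep_future_step mS mxi indep_xi) => //; exact: measurable_state.
Qed.

End state.

Lemma measurable_walk_of phi k : measurable_fun setT phi ->
  measurable_fun setT (walk_of phi k).
Proof.
move=> mphi; have ms := measurable_state mphi mphi k.
exact: measurableT_comp measurable_fst (measurableT_comp measurable_fst ms).
Qed.

Lemma measurable_up_of phi k : measurable_fun setT phi ->
  measurable_fun setT (up_of phi k).
Proof.
move=> mphi; apply: measurableT_comp (measurable_excess c) _.
by apply: measurable_funD; [exact: measurable_walk_of|exact: measurableT_comp].
Qed.

Lemma measurable_ups_of phi k : measurable_fun setT phi ->
  measurable_fun setT (ups_of phi k).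
Proof. by move=> mphi; apply: measurable_sum => i; exact: measurable_up_of. Qed.

Section markov.
Local Open Scope ereal_scope.
Variable psi : R -> R.
Hypothesis mpsi : measurable_fun setT psi.

Definition transition (f : R -> \bar R) (y : R) : \bar R :=
  \int[gamma]_x f (clip c (y + psi x)).

Let mstep : measurable_fun setT (fun z : R * R => clip c (z.1 + psi z.2)).
Proof.
apply: measurableT_comp (measurable_clip c) _.
apply: measurable_funD; first exact: measurable_fst.
exact: measurableT_comp mpsi measurable_snd.
Qed.

Lemma transition_ge0 f : (forall y, 0 <= f y) -> forall y, 0 <= transition f y.
Proof. by move=> f0 y; exact: integral_ge0. Qed.

Lemma measurable_transition f : measurable_fun setT f -> (forall y, 0 <= f y) ->
  measurable_fun setT (transition f).
Proof.
move=> mf f0.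
apply: (measurable_fun_fubini_tonelli_F (m2 := gamma)
  (fun z : R * R => f (clip c (z.1 + psi z.2)))) => //.
exact: measurableT_comp.
Qed.

Lemma iter_transition m f : measurable_fun setT f -> (forall y, 0 <= f y) ->
  measurable_fun setT (iter m transition f) /\
  forall y, 0 <= iter m transition f y.
Proof.
move=> mf f0; elim: m => //= m [mi i0]; split; first exact: measurable_transition.
exact: transition_ge0.
Qed.

Variables (j : nat) (Z : T -> R).
Hypotheses (mZ : measurable_fun setT Z) (Z0 : forall w, (0 <= Z w)%R).
Hypothesis iZ : indep_future P S xi j (fun w => (Z w, walk_of psi j w)).

Lemma indep_future_markov m :
  indep_future P S xi (j + m) (fun w => (Z w, walk_of psi (j + m) w)).
Proof.
elim: m => [|m IH]; first by rewrite addn0.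
rewrite addnS.
apply: (indep_future_comp
  (phi := fun z : (R * R) * R => (z.1.1, clip c (z.1.2 + psi z.2)))
  (H := fun w => ((Z w, walk_of psi (j + m) w), xi (j + m) w))).
  have mpair : measurable_fun setT (fun z : (R * R) * R => (z.1.2, z.2)).
    by apply: measurable_fun_pair => //; exact: measurableT_comp.
  apply: measurable_fun_pair; first exact: measurableT_comp.
  exact: measurableT_comp mstep mpair.
apply: (indep_future_step mS mxi indep_xi) => //.
by apply: measurable_fun_pair => //; exact: measurable_walk_of.
Qed.

(** Integrating out the increment [xi k] against a weight known at time [j]. *)
Lemma markov_step k (f : R * R -> \bar R) : (j <= k)%N ->
  measurable_fun setT f -> (forall z, 0 <= f z) ->
  \int[P]_w ((Z w)%:E * f (walk_of psi k w, xi k w)) =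
  \int[P]_w ((Z w)%:E * \int[gamma]_x f (walk_of psi k w, x)).
Proof.
move=> jk mf f0.
have ik : indep_future P S xi k (fun w => (Z w, walk_of psi k w)).
  by rewrite -(subnKC jk); exact: indep_future_markov.
have mk : measurable_fun setT (fun w => (Z w, walk_of psi k w)).
  by apply: measurable_fun_pair => //; exact: measurable_walk_of.
(* the absolute value makes the integrand nonnegative on the whole product *)
have mf' : measurable_fun setT
    (fun z : (R * R) * R => (`|z.1.1|)%:E * f (z.1.2, z.2)).
  apply: emeasurable_funM.
    by apply/measurable_EFinP; apply: measurableT_comp => //; exact: measurableT_comp.
  apply: measurableT_comp => //; apply: measurable_fun_pair => //.
  exact: measurableT_comp.
transitivity (\int[P]_w ((`|Z w|)%:E * f (walk_of psi k w, xi k w))).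
  by apply: eq_integral => w _; rewrite ger0_norm.
rewrite (integral_step mxi indep_xi mk ik mf'); last first.
  by move=> z; rewrite mule_ge0.
apply: eq_integral => w _ /=; rewrite (ger0_norm (Z0 w)).
have mfw : measurable_fun setT (fun x => f (walk_of psi k w, x)) by exact: measurableT_comp.
by rewrite ge0_integralZl//; rewrite lee_fin.
Qed.

Lemma markov m f : measurable_fun setT f -> (forall y, 0 <= f y) ->
  \int[P]_w ((Z w)%:E * f (walk_of psi (j + m) w)) =
  \int[P]_w ((Z w)%:E * iter m transition f (walk_of psi j w)).
Proof.
elim: m f => [|m IH] f mf f0; first by rewrite addn0.
rewrite addnS iterSr -IH; last 2 first.
  exact: measurable_transition.
  exact: transition_ge0.
rewrite -(markov_step (k := (j + m)%N) (f := fun z : R * R => f (clip c (z.1 + psi z.2))))//.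
  exact: leq_addr.
exact: measurableT_comp.
Qed.

End markov.

Section regeneration.
Local Open Scope ereal_scope.
Variables phi psi : R -> R.
Hypotheses (mphi : measurable_fun setT phi) (mpsi : measurable_fun setT psi).
Hypothesis psiN : forall x, psi x = (- phi x)%R.

Definition mean_up (psi : R -> R) k : \bar R := \int[P]_w (up_of psi k w)%:E.

Lemma mean_up_ge0 (f : R -> R) k : 0 <= mean_up f k.
Proof. by apply: integral_ge0 => w _; rewrite lee_fin up_of_ge0. Qed.

Let expected_excess (y : R) : \bar R := \int[gamma]_x (excess c (y + psi x))%:E.

Let mexcess : measurable_fun setT (fun z : R * R => (excess c (z.1 + psi z.2))%:E).
Proof.
apply/measurable_EFinP; apply: measurableT_comp (measurable_excess c) _.
apply: measurable_funD; first exact: measurable_fst.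
exact: measurableT_comp mpsi measurable_snd.
Qed.

Let expected_excess_ge0 y : 0 <= expected_excess y.
Proof. by apply: integral_ge0 => x _; rewrite lee_fin excess_ge0. Qed.

Let measurable_expected_excess : measurable_fun setT expected_excess.
Proof.
apply: (measurable_fun_fubini_tonelli_F (m2 := gamma)
  (fun z : R * R => (excess c (z.1 + psi z.2))%:E)) => // z.
by rewrite lee_fin excess_ge0.
Qed.

Let mean_up_markov j m (Z : T -> R) : measurable_fun setT Z ->
  (forall w, (0 <= Z w)%R) ->
  indep_future P S xi j (fun w => (Z w, walk_of psi j w)) ->
  \int[P]_w ((Z w)%:E * (up_of psi (j + m) w)%:E) =
  \int[P]_w ((Z w)%:E * iter m (transition psi) expected_excess (walk_of psi j w)).
Proof.
move=> mZ Z0 iZ; rewrite -(markov mpsi mZ Z0 iZ)//.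
rewrite -(markov_step mpsi mZ Z0 iZ (k := (j + m)%N)
  (f := fun z : R * R => (excess c (z.1 + psi z.2))%:E))//.
  exact: leq_addr.
by move=> z; rewrite lee_fin excess_ge0.
Qed.

Lemma mean_up_iter m :
  mean_up psi m = iter m (transition psi) expected_excess 0%R.
Proof.
have := @mean_up_markov 0 m (fun=> 1%R) (@measurable_cst _ _ _ _ _ _) (fun=> ler01).
under eq_integral do rewrite mul1e; rewrite /mean_up => ->.
  under eq_integral do rewrite mul1e /walk_of /=.
  by rewrite integral_cst// -[RHS]mule1; congr (_ * _); exact: probability_setT.
have -> : (fun w => (1%R, walk_of psi 0 w)) = (fun=> (1%R, 0%R)) by [].
exact: indep_future_cst.
Qed.

Lemma up_of_fresh k w : (0 < up_of phi k w)%R -> walk_of psi k.+1 w = 0%R.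
Proof.
have -> : walk_of psi k.+1 w = walk c (\- (fun i => phi (xi i w)))%R k.+1.
  by rewrite /walk_of; congr (walk c _ _); apply/funext => i; rewrite psiN.
exact: up_gt0_walk (ltW c0).
Qed.

Lemma indep_future_up k :
  indep_future P S xi k.+1 (fun w => (up_of phi k w, walk_of psi k.+1 w)).
Proof.
apply: (indep_future_comp
  (phi := fun z : ((R * R) * (R * R)) * R =>
    (excess c (z.1.1.1 + phi z.2), clip c (z.1.1.2 + psi z.2))%R)
  (H := fun w => (state phi psi k w, xi k w))).
  have [p1 p2] := measurable_proposals mphi mpsi.
  by apply: measurable_fun_pair; [exact: measurableT_comp (measurable_excess c) p1|
    exact: measurableT_comp (measurable_clip c) p2].
apply: (indep_future_step mS mxi indep_xi).
  exact: measurable_state.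
exact: indep_future_state.
Qed.

(** Where [up_of phi j] is nonzero, the walk of [psi] is at 0 at time [j.+1]; by
    the Markov property the mean of the later amount is the mean after
    [k - j.+1] steps from the start. *)
Lemma mean_up_product j k : (j < k)%N ->
  \int[P]_w ((up_of phi j w)%:E * (up_of psi k w)%:E) =
  mean_up phi j * mean_up psi (k - j.+1)%N.
Proof.
move=> jk; rewrite -{1}(subnKC jk).
rewrite mean_up_markov; last 3 first.
  exact: measurable_up_of.
  by move=> w; exact: up_of_ge0.
  exact: indep_future_up.
rewrite mean_up_iter; set m := (k - j.+1)%N.
have [_ i0] := iter_transition mpsi m measurable_expected_excess expected_excess_ge0.
rewrite /mean_up -ge0_integralZr//; last 2 first.
  by apply/measurable_EFinP; exact: measurable_up_of.
  by move=> w _; rewrite lee_fin up_of_ge0.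
apply: eq_integral => w _; have := up_of_ge0 phi j w.
rewrite le_eqVlt => /predU1P[<-|/up_of_fresh ->//]; by rewrite !mul0e.
Qed.

End regeneration.

End coupled_walks.

(** * Totals stopped at an independent geometric time *)

Section geometric_clock.
Local Open Scope ereal_scope.
Context d (T : measurableType d) (R : realType) (P : probability T R).
Variables (S : T -> R) (xi : nat -> T -> R) (gamma : probability R R).
Hypothesis mS : measurable_fun setT S.
Hypothesis mxi : forall k, measurable_fun setT (xi k).
Hypothesis indep_xi : forall k B F, measurable B -> future S xi k.+1 F ->
  P (xi k @^-1` B `&` F) = gamma B * P F.
Variables (N : R -> nat) (rho : R).
Hypothesis mN : forall k, measurable [set s | (k < N s)%N].
Hypothesis rho0 : (0 <= rho)%R.
Hypothesis clockE : forall k, P (S @^-1` [set s | (k < N s)%N]) = (rho ^+ k.+1)%:E.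

Let mfunS : {mfun T >-> R} := HB.pack S (isMeasurableFun.Build _ _ _ _ S mS).

(** Rewriting the random number of terms as a full series with indicators allows
    integration term by term. *)
Lemma clocked_sumE (a : nat -> T -> R) w : (forall k, (0 <= a k w)%R) ->
  (\sum_(0 <= k < N (S w)) a k w)%:E =
  \sum_(k <oo) (`|a k w| * \1_[set s | (k < N s)%N] (S w))%:E.
Proof.
move=> a0; rewrite -sumEFin -nneseries_trunc; last by move=> k; rewrite lee_fin.
apply: eq_eseriesr => k _; rewrite ger0_norm// indicE; case: ifPn => kN; first by rewrite mem_set// mulr1.
by rewrite memNset ?mulr0//=; exact/negP.
Qed.

Let mclock k : measurable_fun setT (fun z : R * R => (`|z.1| * \1_[set s | (k < N s)%N] z.2)%:E).
Proof.
apply/measurable_EFinP; apply: measurable_funM.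
  by apply: measurableT_comp => //; exact: measurable_fst.
by apply: measurableT_comp => //; exact: measurable_snd.
Qed.

Lemma measurable_clocked_sum (a : nat -> T -> R) :
  (forall k w, (0 <= a k w)%R) -> (forall k, measurable_fun setT (a k)) ->
  measurable_fun setT (fun w => \sum_(0 <= k < N (S w)) a k w)%R.
Proof.
move=> a0 ma; apply/measurable_EFinP.
have -> : EFin \o (fun w => \sum_(0 <= k < N (S w)) a k w)%R =
    fun w => \sum_(k <oo) (`|a k w| * \1_[set s | (k < N s)%N] (S w))%:E.
  by apply/funext => w /=; exact: clocked_sumE.
apply: ge0_emeasurable_sum => [k w _ _|k _].
  by rewrite lee_fin mulr_ge0.
have mp : measurable_fun setT (fun w => (a k w, S w)) by exact: measurable_fun_pair.
exact: (measurableT_comp (mclock k) mp).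
Qed.

Lemma integral_clocked_sum (a : nat -> T -> R) :
  (forall k w, (0 <= a k w)%R) -> (forall k, measurable_fun setT (a k)) ->
  (forall k, indep_future P S xi k.+1 (a k)) ->
  \int[P]_w (\sum_(0 <= k < N (S w)) a k w)%:E =
  \sum_(k <oo) (rho ^+ k.+1)%:E * \int[P]_w (a k w)%:E.
Proof.
move=> a0 ma ia; under eq_integral do rewrite clocked_sumE//.
rewrite integral_nneseries//; last first.
  move=> k; have mp : measurable_fun setT (fun w => (a k w, S w)) by exact: measurable_fun_pair.
  exact: (measurableT_comp (mclock k) mp).
apply: eq_eseriesr => k _.
rewrite (@integral_product_law _ _ _ P _ _ _ _ (a k) S (distribution P mfunS)
  (ma k) mS _ (fun z : R * R => (`|z.1| * \1_[set s | (k < N s)%N] z.2)%:E) (mclock k)) /=; last 2 first.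
- by move=> A B mA mB; rewrite (indep_future_clock (ia k)).
- by move=> z; rewrite lee_fin mulr_ge0.
rewrite -ge0_integralZl//; last 3 first.
  by apply/measurable_EFinP.
  by move=> w _; rewrite lee_fin.
  by rewrite lee_fin exprn_ge0.
apply: eq_integral => w _.
under eq_integral do rewrite EFinM.
rewrite ge0_integralZl//; last by apply/measurable_EFinP.
by rewrite integral_indic// setIT ger0_norm// -clockE muleC.
Qed.

Variable c : R.
Hypothesis c0 : (0 < c)%R.

(** Summation by parts; the diagonal terms vanish because the two walks cannot
    overshoot at the same step. *)
Lemma clocked_ups_product phi psi w : (forall x, psi x = (- phi x)%R) ->
  (ups_of xi c phi (N (S w)) w * ups_of xi c psi (N (S w)) w =
  \sum_(0 <= k < N (S w)) (up_of xi c phi k w * ups_of xi c psi k w +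
    up_of xi c psi k w * ups_of xi c phi k w))%R.
Proof.
move=> psiN; elim: (N (S w)) => [|k IH]; first by rewrite /ups_of !big_geq// mul0r.
rewrite big_nat_recr//= -IH /ups_of !big_nat_recr//=.
have : (up_of xi c phi k w * up_of xi c psi k w = 0)%R.
  have -> : up_of xi c psi k w = up c (\- (fun i => phi (xi i w)))%R k.
    by rewrite /up_of; congr (up c _ _); apply/funext => i; rewrite psiN.
  exact: up_opp_eq0.
by rewrite mulrDl !mulrDr => ->; lra.
Qed.

Definition mean_ups phi : \bar R := \int[P]_w (ups_of xi c phi (N (S w)) w)%:E.

Lemma mean_upsE (phi : R -> R) : measurable_fun setT phi ->
  mean_ups phi = \sum_(k <oo) (rho ^+ k.+1)%:E * mean_up P xi c phi k.
Proof.
move=> mphi; apply: (integral_clocked_sum (a := up_of xi c phi)).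
- by move=> k w; exact: up_of_ge0.
- by move=> k; exact: measurable_up_of.
move=> k; apply: (indep_future_comp (phi := fst)
  (H := fun w => (up_of xi c phi k w, walk_of xi c (fun x => - phi x)%R k.+1 w))) => //.
apply: (indep_future_up mS mxi indep_xi) => //.
exact: measurableT_comp.
Qed.

(** Each of the two orders of the overshoots contributes the Cauchy product of the
    two series, since the weights [rho ^+ k.+1] are multiplicative in the time
    elapsed before and after the renewal. *)
Lemma mean_ups_product (phi psi : R -> R) : measurable_fun setT phi ->
  measurable_fun setT psi -> (forall x, psi x = (- phi x)%R) ->
  mean_ups phi < +oo -> mean_ups psi < +oo ->
  \int[P]_w (ups_of xi c phi (N (S w)) w * ups_of xi c psi (N (S w)) w)%:E =
  2%:E * (mean_ups phi * mean_ups psi).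
Proof.
move=> mphi mpsi psiN fphi fpsi.
have phiN x : phi x = (- psi x)%R by rewrite psiN opprK.
have mu (f : R -> R) k : measurable_fun setT f -> measurable_fun setT (up_of xi c f k).
  by move=> mf; exact: measurable_up_of.
have mU (f : R -> R) k : measurable_fun setT f -> measurable_fun setT (ups_of xi c f k).
  by move=> mf; exact: measurable_ups_of.
have u0 f k w : (0 <= up_of xi c f k w)%R by exact: up_of_ge0.
have U0 f k w : (0 <= ups_of xi c f k w)%R by exact: ups_of_ge0.
under eq_integral do rewrite (clocked_ups_product _ psiN).
rewrite integral_clocked_sum; last 3 first.
- by move=> k w; rewrite addr_ge0 ?mulr_ge0.
- by move=> k; apply: measurable_funD; apply: measurable_funM; [exact: mu|exact: mU|exact: mu|exact: mU].
- move=> k; have [p1 p2] := measurable_proposals mphi mpsi.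
  have [m1 m2 m3 m4 m5] := @measurable_projections R.
  apply: (indep_future_comp
    (phi := fun z : ((R * R) * (R * R)) * R =>
      (excess c (z.1.1.1 + phi z.2) * z.1.2.2 + excess c (z.1.1.2 + psi z.2) * z.1.2.1)%R)
    (H := fun w => (state xi c phi psi k w, xi k w))).
    by apply: measurable_funD; apply: measurable_funM => //;
      [exact: measurableT_comp (measurable_excess c) p1|
       exact: measurableT_comp (measurable_excess c) p2].
  apply: (indep_future_step mS mxi indep_xi).
    exact: measurable_state.
  exact: (indep_future_state mS mxi indep_xi).
have half (f g : R -> R) k : measurable_fun setT f -> measurable_fun setT g ->
    (forall x, g x = (- f x)%R) ->
    \int[P]_w (up_of xi c f k w * ups_of xi c g k w)%:E =
    \sum_(0 <= j < k) mean_up P xi c g j * mean_up P xi c f (k - j.+1)%N.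
  move=> mf mg gN.
  transitivity (\int[P]_w \sum_(0 <= j < k) ((up_of xi c g j w)%:E * (up_of xi c f k w)%:E)).
    apply: eq_integral => w _; rewrite mulrC /ups_of mulr_suml -sumEFin.
    by apply: eq_bigr => j _; rewrite EFinM.
  rewrite ge0_integral_sum//; last 2 first.
    by move=> j; apply: emeasurable_funM; apply/measurable_EFinP; exact: mu.
    by move=> j w _; rewrite -EFinM lee_fin mulr_ge0.
  apply: eq_big_nat => j /andP[_ jk].
  apply: (mean_up_product mS mxi indep_xi) => //.
  by move=> x; rewrite gN opprK.
have splitD k : \int[P]_w (up_of xi c phi k w * ups_of xi c psi k w +
      up_of xi c psi k w * ups_of xi c phi k w)%:E =
    \sum_(0 <= j < k) mean_up P xi c psi j * mean_up P xi c phi (k - j.+1)%N +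
    \sum_(0 <= j < k) mean_up P xi c phi j * mean_up P xi c psi (k - j.+1)%N.
  under eq_integral do rewrite EFinD.
  rewrite ge0_integralD ?half//.
  - by move=> w _; rewrite lee_fin mulr_ge0.
  - by apply/measurable_EFinP; apply: measurable_funM; [exact: mu|exact: mU].
  - by move=> w _; rewrite lee_fin mulr_ge0.
  - by apply/measurable_EFinP; apply: measurable_funM; [exact: mu|exact: mU].
have p0 f k : 0 <= (rho ^+ k.+1)%:E * mean_up P xi c f k.
  by rewrite mule_ge0 ?lee_fin ?exprn_ge0// mean_up_ge0.
have fin_ser (f : R -> R) : measurable_fun setT f -> mean_ups f < +oo ->
    \sum_(k <oo) (rho ^+ k.+1)%:E * mean_up P xi c f k \is a fin_num.
  move=> mf; rewrite mean_upsE// => h; rewrite ge0_fin_numE//.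
  exact: nneseries_ge0.
have fin_term (f : R -> R) : measurable_fun setT f -> mean_ups f < +oo ->
    forall k, (rho ^+ k.+1)%:E * mean_up P xi c f k \is a fin_num.
  move=> mf h k; rewrite ge0_fin_numE//; apply: le_lt_trans h.
  rewrite mean_upsE// (le_trans _ (nneseries_lim_ge (m := 0) k.+1 _))//.
  rewrite big_nat_recr//= leeDr// sume_ge0//.
have weight f g k : (rho ^+ k.+1)%:E *
    (\sum_(0 <= j < k) mean_up P xi c f j * mean_up P xi c g (k - j.+1)%N) =
    \sum_(0 <= j < k) ((rho ^+ j.+1)%:E * mean_up P xi c f j) *
      ((rho ^+ (k - j.+1).+1)%:E * mean_up P xi c g (k - j.+1)%N).
  rewrite ge0_sume_distrr; last by move=> j _; rewrite mule_ge0// mean_up_ge0.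
  apply: eq_big_nat => j /andP[_ jk]; rewrite muleACA -EFinM -exprD.
  by congr ((rho ^+ _)%:E * _); lia.
transitivity ((mean_ups psi * mean_ups phi) + (mean_ups phi * mean_ups psi)).
  rewrite !mean_upsE//.
  rewrite -!nneseries_cauchy_product ?fin_ser//; last 2 first.
  - exact: fin_term.
  - exact: fin_term.
  rewrite -nneseriesD; last 2 first.
  - by move=> k _ _; apply: sume_ge0 => j _; rewrite mule_ge0.
  - by move=> k _ _; apply: sume_ge0 => j _; rewrite mule_ge0.
  apply: eq_eseriesr => k _; rewrite splitD ge0_muleDr; last 2 first.
  - by apply: sume_ge0 => j _; rewrite mule_ge0// mean_up_ge0.
  - by apply: sume_ge0 => j _; rewrite mule_ge0// mean_up_ge0.
  by rewrite !weight.
by rewrite [X in X + _]muleC -mule2n mule_natl.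
Qed.

End geometric_clock.

(** * Convex test functions and their overshoots *)

Section test_functions.
Context {R : realType}.
Variables (c p q : R).
Hypotheses (c0 : 0 < c) (p0 : 0 < p) (q0 : 0 < q).
Implicit Types A B y : R.

(** The parameters [p] and [- q] will be the two roots r of r ^ 2 / 2 + m r = nu. *)
Definition test_fun A B y : R := A * expR (p * y) + B * expR (- q * y).

Definition overshoot A B y : R := test_fun A B y - test_fun A B (clip c y).

Lemma test_fun_ge0 A B y : 0 <= A -> 0 <= B -> 0 <= test_fun A B y.
Proof. by move=> A0 B0; rewrite addr_ge0// mulr_ge0// expR_ge0. Qed.

Lemma test_fun_le A B y : 0 <= A -> 0 <= B -> 0 <= y -> y <= c ->
  test_fun A B y <= A * expR (p * c) + B.
Proof.
move=> A0 B0 y0 yc; apply: lerD; first by rewrite ler_wpM2l// ler_expR ler_pM2l.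
by rewrite ler_piMr// -expR0 ler_expR mulNr oppr_le0 mulr_ge0// ltW.
Qed.

Lemma overshootE A B y : overshoot A B y =
  A * expR (p * c) * (expR (p * excess c y) - 1) +
  B * expR (- q * c) * (expR (- q * excess c y) - 1) +
  A * (expR (- p * deficit y) - 1) + B * (expR (q * deficit y) - 1).
Proof.
rewrite /overshoot /test_fun /excess /deficit /clip.
have [cy|yc] := leP c y.
  have -> : Num.max 0 c = c by apply/max_idPr; exact: ltW.
  have -> : Num.max (y - c) 0 = y - c by apply/max_idPl; lra.
  have -> : Num.max (- y) 0 = 0 by apply/max_idPr; have := c0; lra.
  rewrite !mulr0 expR0 !subrr !mulr0 !addr0.
  have -> : expR (p * y) = expR (p * c) * expR (p * (y - c)).
    by rewrite -expRD; congr expR; ring.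
  have -> : expR (- q * y) = expR (- q * c) * expR (- q * (y - c)).
    by rewrite -expRD; congr expR; ring.
  by ring.
have -> : Num.max (y - c) 0 = 0 by apply/max_idPr; lra.
have [y0|y0] := leP 0 y.
  have -> : Num.max (- y) 0 = 0 by apply/max_idPr; lra.
  by rewrite !mulr0 expR0; ring.
have -> : Num.max (- y) 0 = - y by apply/max_idPl; lra.
by rewrite !mulr0 expR0 !mulrN !mulNr !opprK; ring.
Qed.

(** Convexity: the test function lies above its tangents at c and at 0. *)
Lemma overshoot_ge A B y : 0 <= A -> 0 <= B ->
  (p * (A * expR (p * c)) - q * (B * expR (- q * c))) * excess c y +
  (q * B - p * A) * deficit y <= overshoot A B y.
Proof.
move=> A0 B0; rewrite overshootE.
have e1 (x : R) : x <= expR x - 1 by have := expR_ge1Dx x; lra.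
have a0 : 0 <= A * expR (p * c) by rewrite mulr_ge0// expR_ge0.
have b0 : 0 <= B * expR (- q * c) by rewrite mulr_ge0// expR_ge0.
have h1 := ler_wpM2l a0 (e1 (p * excess c y)).
have h2 := ler_wpM2l b0 (e1 (- q * excess c y)).
have h3 := ler_wpM2l A0 (e1 (- p * deficit y)).
have h4 := ler_wpM2l B0 (e1 (q * deficit y)).
set a := A * expR _ in h1 *; set b := B * expR _ in h2 *.
have -> : (p * a - q * b) * excess c y + (q * B - p * A) * deficit y =
  a * (p * excess c y) + b * (- q * excess c y) + A * (- p * deficit y) + B * (q * deficit y) by ring.
by lra.
Qed.

(** The second order remainder is at most [kap * o * x] with
    [x = expR (kap * o) - 1]. This is small compared with [o] when [x <= eps], and
    otherwise [x ^+ 2] is absorbed by [x ^+ 4 / eps ^+ 2], whose mean will be of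
    smaller order than the time step. *)
Lemma expR_second_order (kap s o eps : R) : 0 < eps -> 0 <= o ->
  `|s| <= kap -> expR (s * o) - 1 - s * o <=
    kap * eps * o + (expR (kap * o) - 1) ^+ 4 / eps ^+ 2.
Proof.
move=> eps0 o0 skap; have kap0 : 0 <= kap by exact: le_trans skap.
have ko : 0 <= kap * o by rewrite mulr_ge0.
set x := expR (kap * o) - 1.
have xko : kap * o <= x by have := expR_ge1Dx (kap * o); rewrite /x; lra.
have x0 : 0 <= x by lra.
have h1 : expR (s * o) - 1 - s * o <= (s * o) * (expR (s * o) - 1).
  have h := expR_ge1Dx (- (s * o)).
  have := ler_wpM2l (expR_ge0 (s * o)) h.
  by rewrite -expRD subrr expR0; lra.
have h2 : (s * o) * (expR (s * o) - 1) <= kap * o * x.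
  have so : `|s * o| <= kap * o by rewrite normrM (ger0_norm o0) ler_wpM2r.
  apply: le_trans (ler_norm _) _; rewrite normrM ler_pM//.
  rewrite ler_norml; apply/andP; split.
    have := expR_ge1Dx (s * o); move: so; rewrite ler_norml => /andP[]; lra.
  by rewrite lerD2r ler_expR; move: so; rewrite ler_norml => /andP[].
apply: le_trans h1 _; apply: le_trans h2 _.
have e2 : 0 < eps ^+ 2 by rewrite exprn_gt0.
have [xe|ex] := leP x eps.
  have : kap * o * x <= kap * eps * o by rewrite -mulrA (mulrC o) mulrA -!mulrA ler_wpM2l// ler_wpM2r.
  have : 0 <= x ^+ 4 / eps ^+ 2 by rewrite divr_ge0// ?exprn_ge0// ltW.
  by lra.
have : kap * o * x <= x ^+ 4 / eps ^+ 2.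
  apply: (@le_trans _ _ (x ^+ 2)); first by rewrite expr2 ler_wpM2r.
  rewrite ler_pdivlMr// (_ : x ^+ 4 = x ^+ 2 * x ^+ 2); last by rewrite -exprD.
  by rewrite ler_wpM2l ?exprn_ge0// ler_pXn2r ?nnegrE// ltW.
have : 0 <= kap * eps * o by rewrite mulr_ge0// mulr_ge0// ltW.
by lra.
Qed.

(** The tangent bound is sharp up to a small multiple of the overshoots and a
    fourth order term in the increment [x] alone: an overshoot from a point of
    [0, c] is at most [x] upwards and [- x] downwards. *)
Lemma overshoot_le A B y x eps (K := A * expR (p * c) + B) : 0 <= A -> 0 <= B ->
  0 < eps -> 0 <= y <= c ->
  overshoot A B (y + x) <=
    (p * (A * expR (p * c)) - q * (B * expR (- q * c))) * excess c (y + x) +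
    (q * B - p * A) * deficit (y + x) +
    K * ((p + q) * eps * (excess c (y + x) + deficit (y + x)) +
      ((expR ((p + q) * x) - 1) ^+ 4 + (expR (- (p + q) * x) - 1) ^+ 4) / eps ^+ 2).
Proof.
move=> A0 B0 eps0 /andP[y0 yc]; rewrite overshootE.
set o := excess c (y + x); set v := deficit (y + x).
have o0 : 0 <= o by exact: excess_ge0.
have v0 : 0 <= v by exact: deficit_ge0.
set a := A * expR (p * c); set b := B * expR (- q * c).
have a0 : 0 <= a by rewrite mulr_ge0// expR_ge0.
have b0 : 0 <= b by rewrite mulr_ge0// expR_ge0.
have bB : b <= B.
  by rewrite ler_piMr// -expR0 ler_expR mulNr oppr_le0 mulr_ge0// ltW.
have Aa : A <= a.
  by rewrite ler_peMr// -expR0 ler_expR mulr_ge0// ltW.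
have [p0' q0'] : 0 < p /\ 0 < q by [].
have pk : `|p| <= p + q by rewrite gtr0_norm//; lra.
have qk : `|q| <= p + q by rewrite gtr0_norm//; lra.
have npk : `|- p| <= p + q by rewrite normrN.
have nqk : `|- q| <= p + q by rewrite normrN.
have kap0 : 0 <= p + q by lra.
have quart (s t : R) : 0 <= s -> (s <= t) || (s == 0) -> (expR s - 1) ^+ 4 <= (expR t - 1) ^+ 4.
  move=> s0 /orP[st|/eqP ->]; last first.
    by rewrite expR0 subrr expr0n/= exprn_even_ge0.
  have e0 (r : R) : 0 <= r -> expR r - 1 \is Num.nneg.
    by move=> r0; rewrite nnegrE subr_ge0 -expR0 ler_expR.
  by rewrite lerXn2r ?e0 ?(le_trans s0 st)// lerD2r ler_expR.
have hx1 : (expR ((p + q) * o) - 1) ^+ 4 <= (expR ((p + q) * x) - 1) ^+ 4.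
  apply: quart; first by rewrite mulr_ge0.
  rewrite /o /excess; have [h|h] := leP (y + x - c) 0; last by rewrite ler_wpM2l//; lra.
  by rewrite mulr0 eqxx orbT.
have hx2 : (expR ((p + q) * v) - 1) ^+ 4 <= (expR (- (p + q) * x) - 1) ^+ 4.
  apply: quart; first by rewrite mulr_ge0.
  rewrite /v /deficit; have [h|h] := leP (- (y + x)) 0; first by rewrite mulr0 eqxx orbT.
  by rewrite mulNr -mulrN ler_wpM2l//; lra.
have ie2 : 0 <= (eps ^+ 2)^-1 by rewrite invr_ge0 exprn_ge0// ltW.
set Q1 := (expR ((p + q) * x) - 1) ^+ 4 in hx1 *.
set Q2 := (expR (- (p + q) * x) - 1) ^+ 4 in hx2 *.
pose bo := (p + q) * eps * o + Q1 / eps ^+ 2.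
pose bv := (p + q) * eps * v + Q2 / eps ^+ 2.
have so (s : R) : `|s| <= p + q -> expR (s * o) - 1 <= s * o + bo.
  move=> sk; have := expR_second_order eps0 o0 sk; have := ler_wpM2r ie2 hx1.
  by rewrite /bo; lra.
have sv (s : R) : `|s| <= p + q -> expR (s * v) - 1 <= s * v + bv.
  move=> sk; have := expR_second_order eps0 v0 sk; have := ler_wpM2r ie2 hx2.
  by rewrite /bv; lra.
have bo0 : 0 <= bo.
  apply: addr_ge0; last by apply: mulr_ge0 => //; exact: exprn_even_ge0.
  by apply: mulr_ge0 => //; apply: mulr_ge0 => //; exact: ltW.
have bv0 : 0 <= bv.
  apply: addr_ge0; last by apply: mulr_ge0 => //; exact: exprn_even_ge0.
  by apply: mulr_ge0 => //; apply: mulr_ge0 => //; exact: ltW.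
have h1 := ler_wpM2l a0 (so _ pk); have h2 := ler_wpM2l b0 (so _ nqk).
have h3 := ler_wpM2l A0 (sv _ npk); have h4 := ler_wpM2l B0 (sv _ qk).
have g1 : (a + b) * bo <= K * bo by rewrite ler_wpM2r// lerD2l.
have g2 : (A + B) * bv <= K * bv by rewrite ler_wpM2r// lerD2r.
have -> : K * ((p + q) * eps * (o + v) + (Q1 + Q2) / eps ^+ 2) = K * bo + K * bv.
  by rewrite /bo /bv; ring.
apply: le_trans (lerD (lerD (lerD h1 h2) h3) h4) _.
have -> : a * (p * o + bo) + b * (- q * o + bo) + A * (- p * v + bv) + B * (q * v + bv)
  = (p * a - q * b) * o + (q * B - p * A) * v + ((a + b) * bo + (A + B) * bv) by ring.
by lra.
Qed.

End test_functions.

(** * The discounted martingale of a test function *)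

Section exit_identity.
Local Open Scope ereal_scope.
Context d (T : measurableType d) (R : realType) (P : probability T R).
Variables (S : T -> R) (xi : nat -> T -> R) (gamma : probability R R).
Hypothesis mS : measurable_fun setT S.
Hypothesis mxi : forall k, measurable_fun setT (xi k).
Hypothesis indep_xi : forall k B F, measurable B -> future S xi k.+1 F ->
  P (xi k @^-1` B `&` F) = gamma B * P F.
Variables (c rho : R) (phi : R -> R) (p q : R).
Hypothesis c0 : (0 < c)%R.
Hypothesis rho01 : (0 < rho < 1)%R.
Hypothesis mphi : measurable_fun setT phi.
Hypotheses (p0 : (0 < p)%R) (q0 : (0 < q)%R).
Hypothesis mgf_p : \int[gamma]_x (expR (p * phi x))%:E = (rho^-1)%:E.
Hypothesis mgf_q : \int[gamma]_x (expR (- q * phi x))%:E = (rho^-1)%:E.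

Local Notation X := (walk_of xi c phi).

Lemma measurable_test_fun A B : measurable_fun setT (test_fun p q A B).
Proof.
by apply: measurable_funD; apply: measurable_funM => //;
  apply: measurableT_comp => //; apply: measurable_funM.
Qed.

Lemma measurable_overshoot A B : measurable_fun setT (overshoot c p q A B).
Proof.
apply: measurable_funB; first exact: measurable_test_fun.
exact: measurableT_comp (measurable_test_fun A B) (measurable_clip c).
Qed.

Lemma measurable_proposal k : measurable_fun setT (fun w => X k w + phi (xi k w))%R.
Proof.
by apply: measurable_funD; [exact: measurable_walk_of|exact: measurableT_comp].
Qed.

(** Both exponentials are eigenfunctions of a free step, with eigenvalue
    [rho^-1]. *)
Lemma mean_test_fun_step A B y : (0 <= A)%R -> (0 <= B)%R ->
  \int[gamma]_x (test_fun p q A B (y + phi x))%:E =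
  (rho^-1 * test_fun p q A B y)%:E.
Proof.
move=> A0 B0.
have e r s C : (expR (r * (y + s)) = expR (r * y) * expR (r * s))%R /\
    (C * (expR (r * y) * expR (r * s)) = (C * expR (r * y)) * expR (r * s))%R.
  by rewrite mulrDr expRD mulrA.
under eq_integral => x _.
  rewrite /test_fun (e p _ A).1 (e (- q)%R _ B).1 (e p _ A).2 (e (- q)%R _ B).2.
  rewrite EFinD [in X in X + _]EFinM [in X in _ + X]EFinM.
  over.
have me r : measurable_fun setT (fun x => (expR (r * phi x))%:E).
  by apply/measurable_EFinP; apply: measurableT_comp => //; apply: measurable_funM.
have a0 r C : (0 <= C -> 0 <= C * expR (r * y))%R by move=> ?; rewrite mulr_ge0 ?expR_ge0.
have i0 r C x : (0 <= C)%R -> 0 <= (C * expR (r * y))%:E * (expR (r * phi x))%:E.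
  by move=> C0; rewrite -EFinM lee_fin mulr_ge0 ?expR_ge0 ?a0.
have mi r C : measurable_fun setT (fun x => (C * expR (r * y))%:E * (expR (r * phi x))%:E).
  exact: measurable_funeM.
have E r C : (0 <= C)%R ->
    \int[gamma]_x ((C * expR (r * y))%:E * (expR (r * phi x))%:E) =
    (C * expR (r * y))%:E * \int[gamma]_x (expR (r * phi x))%:E.
  by move=> C0; rewrite ge0_integralZl// ?lee_fin ?a0// => x _; rewrite lee_fin expR_ge0.
rewrite ge0_integralD//; [|by move=> x _; exact: i0..].
rewrite !E//.
by rewrite mgf_p mgf_q -!EFinM -EFinD /test_fun; congr EFin; ring.
Qed.

Section test_function.
Variables A B : R.
Hypotheses (A0 : (0 <= A)%R) (B0 : (0 <= B)%R).
Hypothesis slope0 : (0 <= q * B - p * A)%R.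
Hypothesis slopec :
  (0 <= p * (A * expR (p * c)) - q * (B * expR (- q * c)))%R.

Lemma overshoot_ge0 y : (0 <= overshoot c p q A B y)%R.
Proof.
apply: le_trans _ (overshoot_ge p q c0 y A0 B0).
by rewrite addr_ge0// mulr_ge0// ?excess_ge0// deficit_ge0.
Qed.

Definition mean_overshoot k : \bar R :=
  \int[P]_w (overshoot c p q A B (X k w + phi (xi k w)))%:E.

Let mean_test k : \bar R := \int[P]_w (test_fun p q A B (X k w))%:E.

Let mean_test_ge0 k : 0 <= mean_test k.
Proof. by apply: integral_ge0 => w _; rewrite lee_fin test_fun_ge0. Qed.

Lemma mean_overshoot_ge0 k : 0 <= mean_overshoot k.
Proof. by apply: integral_ge0 => w _; rewrite lee_fin overshoot_ge0. Qed.

Let mean_test_le k : mean_test k <= (A * expR (p * c) + B)%:E.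
Proof.
apply: (@le_trans _ _ (\int[P]_w (A * expR (p * c) + B)%:E)).
  apply: ge0_le_integral => //.
  - by move=> w _; rewrite lee_fin test_fun_ge0.
  - apply/measurable_EFinP; apply: measurableT_comp (measurable_test_fun A B) _.
    exact: measurable_walk_of.
  - move=> w _; rewrite lee_fin test_fun_le//; first exact: walk_ge0.
    by apply: walk_le; exact: ltW.
rewrite integral_cst//= -[leRHS]mule1 lee_wpmul2l//.
  by rewrite lee_fin addr_ge0// mulr_ge0// expR_ge0.
exact: probability_le1.
Qed.

Let mean_test_step k :
  mean_test k = rho%:E * mean_overshoot k + rho%:E * mean_test k.+1.
Proof.
have r0 : (0 < rho)%R by case/andP: rho01.
have mt : measurable_fun setT (fun z : R * R => (test_fun p q A B (z.1 + phi z.2))%:E).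
  apply/measurable_EFinP; apply: measurableT_comp (measurable_test_fun A B) _.
  by apply: measurable_funD; [exact: measurable_fst|exact: measurableT_comp mphi measurable_snd].
have h : (rho^-1)%:E * mean_test k =
    \int[P]_w (test_fun p q A B (X k w + phi (xi k w)))%:E.
  have i1 : indep_future P S xi 0 (fun w => (1%R : R, X 0 w)).
    have -> : (fun w => (1%R, X 0 w)) = (fun=> (1%R, 0%R)) by [].
    exact: indep_future_cst.
  have := @markov_step _ _ _ P S xi gamma mS mxi indep_xi c phi mphi 0 (fun=> 1%R)
    (measurable_cst _) (fun=> ler01) i1 k _ (leq0n k) mt.
  under eq_integral do rewrite mul1e /=.
  move=> ->; last by move=> z; rewrite lee_fin test_fun_ge0.
  rewrite -ge0_integralZl//; last 3 first.
  - apply/measurable_EFinP; apply: measurableT_comp (measurable_test_fun A B) _.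
    exact: measurable_walk_of.
  - by move=> w _; rewrite lee_fin test_fun_ge0.
  - by rewrite lee_fin invr_ge0 ltW.
  by apply: eq_integral => w _; rewrite mul1e mean_test_fun_step.
have : \int[P]_w (test_fun p q A B (X k w + phi (xi k w)))%:E =
    mean_overshoot k + mean_test k.+1.
  rewrite -ge0_integralD//.
  - by apply: eq_integral => w _; rewrite -EFinD /overshoot subrK.
  - by move=> w _; rewrite lee_fin overshoot_ge0.
  - apply/measurable_EFinP; apply: measurableT_comp (measurable_overshoot A B) _.
    exact: measurable_proposal.
  - by move=> w _; rewrite lee_fin test_fun_ge0.
  - apply/measurable_EFinP; apply: measurableT_comp (measurable_test_fun A B) _.
    exact: measurable_walk_of.
rewrite -h => /(congr1 (mule rho%:E)); rewrite muleA -EFinM divff ?gt_eqF// mul1e => ->.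
by rewrite ge0_muleDr// ?mean_overshoot_ge0.
Qed.

Let partial_sum_mean_overshoot n : (test_fun p q A B 0)%:E =
  \sum_(0 <= k < n) (rho ^+ k.+1)%:E * mean_overshoot k + (rho ^+ n)%:E * mean_test n.
Proof.
elim: n => [|n ->].
  rewrite big_geq// add0e expr0 mul1e /mean_test.
  rewrite (integral_cst P measurableT (test_fun p q A B 0)%:E) -[LHS]mule1.
  by congr (_ * _); rewrite [RHS]probability_setT.
rewrite big_nat_recr//= -addeA; congr (_ + _).
rewrite {1}mean_test_step ge0_muleDr ?mule_ge0 ?mean_overshoot_ge0//; last 2 first.
  by rewrite lee_fin; case/andP: rho01 => /ltW.
  by rewrite lee_fin; case/andP: rho01 => /ltW.
by rewrite !muleA -!EFinM -exprSr.
Qed.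

(** Without clipping, [rho ^+ k] times the mean of the test function would be
    constant in [k]; what clipping takes away at each step telescopes, and the
    discounted mean tends to 0 because the walk is bounded. *)
Lemma sum_mean_overshoot :
  \sum_(k <oo) (rho ^+ k.+1)%:E * mean_overshoot k = (test_fun p q A B 0)%:E.
Proof.
have [r0 r1] : (0 <= rho)%R /\ (rho < 1)%R by case/andP: rho01 => /ltW.
have s0 k : 0 <= (rho ^+ k.+1)%:E * mean_overshoot k.
  by rewrite mule_ge0 ?mean_overshoot_ge0// lee_fin exprn_ge0.
have t0 n : 0 <= (rho ^+ n)%:E * mean_test n by rewrite mule_ge0// lee_fin exprn_ge0.
apply/eqP; rewrite eq_le; apply/andP; split.
  apply: lime_le; first exact: is_cvg_nneseries.
  by apply: nearW => n; rewrite (partial_sum_mean_overshoot n) leeDl.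
have le_n n : (test_fun p q A B 0)%:E <=
    \sum_(k <oo) (rho ^+ k.+1)%:E * mean_overshoot k +
    (rho ^+ n * (A * expR (p * c) + B))%:E.
  rewrite (partial_sum_mean_overshoot n); apply: leeD; first exact: nneseries_lim_ge.
  by rewrite EFinM lee_wpmul2l// lee_fin exprn_ge0.
have : 0 <= \sum_(k <oo) (rho ^+ k.+1)%:E * mean_overshoot k by exact: nneseries_ge0.
move: le_n; set sigma := \sum_(k <oo) _; case: sigma => [s| |//]; last by move=> *; exact: leey.
move=> le_n _; rewrite lee_fin.
have cv : (s + rho ^+ n * (A * expR (p * c) + B) @[n --> \oo] --> s)%R.
  rewrite -[X in _ --> X]addr0 -(mul0r (A * expR (p * c) + B)%R).
  apply: cvgD; first exact: cvg_cst.
  by apply: cvgM; [apply: cvg_expr; rewrite ger0_norm|exact: cvg_cst].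
apply: (cvgr_to_ge cv); apply: nearW => n.
by have := le_n n; rewrite -EFinD lee_fin.
Qed.

End test_function.
End exit_identity.

(** * Two-sided bounds for the mean of the stopped total *)

Section mean_upward_variation.
Local Open Scope ereal_scope.
Context d (T : measurableType d) (R : realType) (P : probability T R).
Variables (S : T -> R) (xi : nat -> T -> R) (gamma : probability R R).
Hypothesis mS : measurable_fun setT S.
Hypothesis mxi : forall k, measurable_fun setT (xi k).
Hypothesis indep_xi : forall k B F, measurable B -> future S xi k.+1 F ->
  P (xi k @^-1` B `&` F) = gamma B * P F.
Variables (N : R -> nat) (c rho : R) (phi : R -> R) (p q : R).
Hypothesis mN : forall k, measurable [set s | (k < N s)%N].
Hypothesis c0 : (0 < c)%R.
Hypothesis rho01 : (0 < rho < 1)%R.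
Hypothesis clockE : forall k, P (S @^-1` [set s | (k < N s)%N]) = (rho ^+ k.+1)%:E.
Hypothesis mphi : measurable_fun setT phi.
Hypotheses (p0 : (0 < p)%R) (q0 : (0 < q)%R).
Hypothesis mgf_p : \int[gamma]_x (expR (p * phi x))%:E = (rho^-1)%:E.
Hypothesis mgf_q : \int[gamma]_x (expR (- q * phi x))%:E = (rho^-1)%:E.

Lemma geometric_sum_le :
  \sum_(k <oo) (rho ^+ k.+1)%:E <= (rho / (1 - rho))%:E.
Proof.
have [r0 r1] : (0 < rho)%R /\ (rho < 1)%R by apply/andP.
apply: lime_le.
  by apply: is_cvg_nneseries => k _ _; rewrite lee_fin exprn_ge0// ltW.
apply: nearW => n; rewrite sumEFin lee_fin.
have d1 : (1 - rho != 0)%R by lra.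
have -> : (\sum_(0 <= k < n) rho ^+ k.+1 = (rho - rho ^+ n.+1) / (1 - rho))%R.
  elim: n => [|n IH]; first by rewrite big_geq// expr1 subrr mul0r.
  by rewrite big_nat_recr//= IH !exprS; field.
by rewrite ler_wpM2r ?invr_ge0 ?gerBl ?exprn_ge0//; lra.
Qed.

(* A test function of slope 0 at 0 and slope 1 at c *)
Variables A B : R.
Hypotheses (A0 : (0 <= A)%R) (B0 : (0 <= B)%R).
Hypothesis slope0 : (q * B - p * A = 0)%R.
Hypothesis slopec :
  (p * (A * expR (p * c)) - q * (B * expR (- q * c)) = 1)%R.

Local Notation ov A B k := (mean_overshoot P xi c phi p q A B k).

Lemma mean_upsE_rho : mean_ups P S xi N c phi =
  \sum_(k <oo) (rho ^+ k.+1)%:E * mean_up P xi c phi k.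
Proof.
by apply: (mean_upsE mS mxi indep_xi mN) => //; case/andP: rho01 => /ltW.
Qed.

Let rho_ge0 k : 0 <= (rho ^+ k)%:E.
Proof. by rewrite lee_fin exprn_ge0//; case/andP: rho01 => /ltW. Qed.

Let measurable_ov A' B' k :
  measurable_fun setT (fun w => (overshoot c p q A' B' (walk_of xi c phi k w + phi (xi k w)))%:E).
Proof.
apply/measurable_EFinP; apply: measurableT_comp (measurable_overshoot c p q A' B') _.
exact: measurable_proposal.
Qed.

Lemma mean_ups_le : mean_ups P S xi N c phi <= (test_fun p q A B 0)%:E.
Proof.
rewrite mean_upsE_rho -(sum_mean_overshoot mS mxi indep_xi c0 rho01 mphi p0 q0 mgf_p mgf_q A0 B0);
  [|by rewrite slope0|by rewrite slopec].
apply: lee_nneseries => [k _ _|k _]; first by rewrite mule_ge0// mean_up_ge0.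
rewrite lee_wpmul2l//; apply: ge0_le_integral => //.
- by move=> w _; rewrite lee_fin up_of_ge0.
- by apply/measurable_EFinP; exact: measurable_up_of.
- move=> w _; rewrite lee_fin; apply: le_trans _ (overshoot_ge p q c0 _ A0 B0).
  by rewrite slope0 slopec mul0r mul1r addr0.
Qed.

(* A second test function, of slope -1 at 0 and slope 1 at c: its overshoots
   dominate the amounts cut off at both ends. *)
Variables A' B' : R.
Hypotheses (A'0 : (0 <= A')%R) (B'0 : (0 <= B')%R).
Hypothesis slope0' : (q * B' - p * A' = 1)%R.
Hypothesis slopec' :
  (p * (A' * expR (p * c)) - q * (B' * expR (- q * c)) = 1)%R.

Definition fourth_order (x : R) : R :=
  (expR ((p + q) * phi x) - 1) ^+ 4 + (expR (- (p + q) * phi x) - 1) ^+ 4.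

Lemma fourth_order_ge0 x : (0 <= fourth_order x)%R.
Proof. by rewrite addr_ge0// exprn_even_ge0. Qed.

Lemma measurable_fourth_order : measurable_fun setT fourth_order.
Proof.
by apply: measurable_funD; apply: measurable_funX; apply: measurable_funB => //;
  apply: measurableT_comp => //; apply: measurable_funM.
Qed.

Variables (eps m : R).
Hypotheses (eps0 : (0 < eps)%R).
Hypothesis fourth_moment : \int[gamma]_x (fourth_order x)%:E <= m%:E.

Lemma mean_fourth_order_le k : \int[P]_w (fourth_order (xi k w))%:E <= m%:E.
Proof.
apply: le_trans fourth_moment.
have i1 : indep_future P S xi k (fun w : T => 0%R : R) by exact: indep_future_cst.
rewrite (integral_step mxi indep_xi (@measurable_cst _ _ _ _ _ _) i1
  (F := fun z : R * R => (fourth_order z.2)%:E)); last 2 first.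
- apply/measurable_EFinP; apply: measurableT_comp measurable_fourth_order _.
  exact: measurable_snd.
- by move=> z; rewrite lee_fin fourth_order_ge0.
rewrite (integral_cst P measurableT (\int[gamma]_x (fourth_order x)%:E)).
rewrite -[leRHS]mule1 lee_wpmul2l ?probability_le1//.
by apply: integral_ge0 => x _; rewrite lee_fin fourth_order_ge0.
Qed.

(** The second test function controls the total of the first order error terms of
    [overshoot_le], and the fourth moment controls the rest. *)
Lemma mean_ups_ge (K := (A * expR (p * c) + B)%R) :
  (test_fun p q A B 0)%:E <= mean_ups P S xi N c phi +
    (K * ((p + q) * eps * test_fun p q A' B' 0 + m * (rho / (1 - rho)) / eps ^+ 2))%:E.
Proof.
have K0 : (0 <= K)%R by rewrite addr_ge0// mulr_ge0// expR_ge0.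
have pq0 : (0 <= p + q)%R by rewrite addr_ge0// ltW.
have e2 : (0 <= (eps ^+ 2)^-1)%R by rewrite invr_ge0 exprn_ge0// ltW.
have L0 : (0 <= K * ((p + q) * eps))%R by rewrite !mulr_ge0// ltW.
have M0 : (0 <= K / eps ^+ 2)%R by rewrite mulr_ge0.
have m0 : (0 <= m)%R.
  rewrite -lee_fin; apply: le_trans fourth_moment.
  by apply: integral_ge0 => x _; rewrite lee_fin fourth_order_ge0.
have ov0 y : (0 <= overshoot c p q A' B' y)%R.
  by apply: overshoot_ge0 => //; rewrite ?slope0' ?slopec'.
have le_k k : ov A B k <= mean_up P xi c phi k +
    ((K * ((p + q) * eps))%:E * ov A' B' k + (K / eps ^+ 2 * m)%:E).
  apply: (@le_trans _ _ (\int[P]_w ((up_of xi c phi k w)%:E +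
      ((K * ((p + q) * eps))%:E *
        (overshoot c p q A' B' (walk_of xi c phi k w + phi (xi k w)))%:E +
       (K / eps ^+ 2)%:E * (fourth_order (xi k w))%:E)))).
    apply: ge0_le_integral => //.
    - move=> w _; rewrite lee_fin; apply: overshoot_ge0 => //; first by rewrite slope0.
      by rewrite slopec.
    - apply: emeasurable_funD.
        by apply/measurable_EFinP; exact: measurable_up_of.
      apply: emeasurable_funD; apply: measurable_funeM; first exact: measurable_ov.
      by apply/measurable_EFinP; exact: measurableT_comp measurable_fourth_order _.
    - move=> w _; rewrite -!EFinM -!EFinD lee_fin.
      have Xw : (0 <= walk_of xi c phi k w <= c)%R.
        by rewrite walk_ge0 walk_le// ltW.
      apply: le_trans (overshoot_le c0 p0 q0 (phi (xi k w)) A0 B0 eps0 Xw) _.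
      rewrite slope0 slopec mul0r mul1r addr0 -/K.
      have := overshoot_ge p q c0 (walk_of xi c phi k w + phi (xi k w)) A'0 B'0.
      rewrite slope0' slopec' !mul1r => h.
      rewrite lerD2l mulrDr lerD//; last by rewrite -/(fourth_order _) mulrAC mulrA.
      by rewrite !mulrA ler_wpM2l// -mulrA.
  have mo : measurable_fun setT (fun w => (K * ((p + q) * eps))%:E *
      (overshoot c p q A' B' (walk_of xi c phi k w + phi (xi k w)))%:E).
    by apply: measurable_funeM; exact: measurable_ov.
  have mf : measurable_fun setT (fun w => (fourth_order (xi k w))%:E).
    by apply/measurable_EFinP; exact: measurableT_comp measurable_fourth_order _.
  have o0 w : 0 <= (K * ((p + q) * eps))%:E *
      (overshoot c p q A' B' (walk_of xi c phi k w + phi (xi k w)))%:E.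
    by rewrite mule_ge0 ?lee_fin ?ov0.
  have f0 w : 0 <= (K / eps ^+ 2)%:E * (fourth_order (xi k w))%:E.
    by rewrite mule_ge0 ?lee_fin ?fourth_order_ge0.
  have mmf : measurable_fun setT (fun w => (K / eps ^+ 2)%:E * (fourth_order (xi k w))%:E).
    exact: measurable_funeM.
  rewrite ge0_integralD//; last 4 first.
  - by move=> w _; rewrite lee_fin up_of_ge0.
  - by apply/measurable_EFinP; exact: measurable_up_of.
  - by move=> w _; rewrite adde_ge0.
  - exact: emeasurable_funD.
  rewrite leeD2l// ge0_integralD// leeD//.
    by rewrite ge0_integralZl ?lee_fin// => w _; rewrite lee_fin.
  rewrite ge0_integralZl//; last by move=> w _; rewrite lee_fin fourth_order_ge0.
  by rewrite [leRHS]EFinM lee_wpmul2l// mean_fourth_order_le.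
have ov_ge0 k : 0 <= ov A' B' k by apply: mean_overshoot_ge0 => //; rewrite ?slope0' ?slopec'.
rewrite -(sum_mean_overshoot mS mxi indep_xi c0 rho01 mphi p0 q0 mgf_p mgf_q A0 B0);
  [|by rewrite slope0|by rewrite slopec].
have expand (r x y z t : \bar R) : 0 <= x -> 0 <= y -> 0 <= z -> 0 <= t ->
    r * (x + (y * z + t)) = r * x + (y * (r * z) + t * r).
  move=> x0 y0 z0 t0; rewrite ge0_muleDr//; last by rewrite adde_ge0// mule_ge0.
  by rewrite ge0_muleDr ?mule_ge0// muleCA [t * r]muleC.
apply: (@le_trans _ _ (\sum_(k <oo) ((rho ^+ k.+1)%:E * mean_up P xi c phi k +
    ((K * ((p + q) * eps))%:E * ((rho ^+ k.+1)%:E * ov A' B' k) +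
     (K / eps ^+ 2 * m)%:E * (rho ^+ k.+1)%:E)))).
  apply: lee_nneseries => [k _ _|k _].
    by rewrite mule_ge0//; apply: mean_overshoot_ge0 => //; rewrite ?slope0 ?slopec.
  apply: (le_trans (lee_wpmul2l (rho_ge0 k.+1) (le_k k))).
  by rewrite expand// ?lee_fin ?mulr_ge0// mean_up_ge0.
have u0 k : 0 <= (rho ^+ k.+1)%:E * mean_up P xi c phi k by rewrite mule_ge0// mean_up_ge0.
have v0 k : 0 <= (K * ((p + q) * eps))%:E * ((rho ^+ k.+1)%:E * ov A' B' k).
  by rewrite !mule_ge0.
have w0 k : 0 <= (K / eps ^+ 2 * m)%:E * (rho ^+ k.+1)%:E.
  by rewrite mule_ge0// lee_fin mulr_ge0.
rewrite nneseriesD; [|by move=> *; exact: u0|by move=> *; exact: adde_ge0].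
rewrite -mean_upsE_rho leeD2l//.
rewrite nneseriesD; [|by move=> *; exact: v0|by move=> *; exact: w0].
rewrite nneseriesZl; last by move=> k _; exact: mule_ge0.
rewrite (sum_mean_overshoot mS mxi indep_xi c0 rho01 mphi p0 q0 mgf_p mgf_q A'0 B'0);
  [|by rewrite slope0'|by rewrite slopec'].
rewrite nneseriesZl; last by move=> k _; exact: rho_ge0.
apply: (@le_trans _ _ ((K * ((p + q) * eps))%:E * (test_fun p q A' B' 0)%:E +
   (K / eps ^+ 2 * m)%:E * (rho / (1 - rho))%:E)).
  by rewrite leeD2l// lee_wpmul2l ?geometric_sum_le// lee_fin mulr_ge0.
by rewrite -!EFinM -EFinD lee_fin le_eqVlt; apply/orP; left; apply/eqP; ring.
Qed.

End mean_upward_variation.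

(** * Gaussian exponential moments and the exponential tail *)

Section density.
Local Open Scope ereal_scope.
Context d (T : measurableType d) (R : realType).
Variables (mu nu : {measure set T -> \bar R}) (h : T -> R).
Hypothesis mh : measurable_fun setT h.
Hypothesis h0 : forall x, (0 <= h x)%R.
Hypothesis nuE : forall A, measurable A -> nu A = \int[mu]_(x in A) (h x)%:E.

Import HBNNSimple.

Let integral_density_indic A : measurable A ->
  \int[nu]_x (\1_A x)%:E = \int[mu]_x ((\1_A x)%:E * (h x)%:E).
Proof.
move=> mA; rewrite integral_indic// setIT nuE// integral_mkcond.
apply: eq_integral => x _; rewrite patchE indicE.
by case: ifP => _; rewrite ?mul1e ?mul0e.
Qed.

Let integral_density_nnsfun (f : {nnsfun T >-> R}) :
  \int[nu]_x (f x)%:E = \int[mu]_x ((f x)%:E * (h x)%:E).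
Proof.
under [LHS]eq_integral do rewrite fimfunE -fsumEFin//.
rewrite [LHS]ge0_integral_fsum//; last 2 first.
  - by move=> r; exact/measurable_EFinP/measurableT_comp.
  - by move=> n x _; rewrite EFinM nnfun_muleindic_ge0.
under [RHS]eq_integral.
  move=> x xD; rewrite muleC fimfunE -fsumEFin// ge0_mule_fsumr; last first.
    by move=> r; rewrite EFinM nnfun_muleindic_ge0.
  over.
rewrite [RHS]ge0_integral_fsum//; last 2 first.
  - move=> r; apply: emeasurable_funM; first exact/measurable_EFinP.
    exact/measurable_EFinP/measurableT_comp.
  - by move=> n x _; apply: mule_ge0; [rewrite lee_fin|rewrite EFinM nnfun_muleindic_ge0].
apply: eq_fsbigr => r _.
rewrite integralZl_indic_nnsfun// integral_density_indic//.
have [r0|r0] := leP 0%R r.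
  rewrite -ge0_integralZl//; last 2 first.
  - apply: emeasurable_funM; last exact/measurable_EFinP.
    exact/measurable_EFinP/measurable_indic.
  - by move=> x _; rewrite mule_ge0// lee_fin.
  by apply: eq_integral => x _; rewrite muleA -EFinM muleC.
rewrite preimage_nnfun0//.
under eq_integral do rewrite indic0 mul0e.
under [RHS]eq_integral do rewrite indic0 mulr0 mule0.
by rewrite !integral0 mule0.
Qed.

Lemma ge0_integral_density (f : T -> \bar R) :
  measurable_fun setT f -> (forall x, 0 <= f x) ->
  \int[nu]_x f x = \int[mu]_x (f x * (h x)%:E).
Proof.
move=> mf f0; pose g := nnsfun_approx measurableT mf.
transitivity (limn (fun n => \int[nu]_x (g n x)%:E)).
  rewrite -monotone_convergence//=.
  - apply: eq_integral => x _; apply/esym/cvg_lim => //=.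
    exact: cvg_nnsfun_approx.
  - by move=> n; exact/measurable_EFinP/measurable_funTS.
  - by move=> n x _; rewrite lee_fin.
  - by move=> x _ a b ab; rewrite lee_fin; exact/lefP/nd_nnsfun_approx.
transitivity (limn (fun n => \int[mu]_x ((g n x)%:E * (h x)%:E))).
  by congr (limn _); apply/funext => n; exact: integral_density_nnsfun.
rewrite -monotone_convergence//=.
- apply: eq_integral => x _; apply/cvg_lim => //=.
  apply: cvgeZr => //; exact: cvg_nnsfun_approx.
- move=> n; apply: emeasurable_funM; last exact/measurable_EFinP.
  exact/measurable_EFinP/measurable_funTS.
- by move=> n x _; rewrite mule_ge0// lee_fin.
- move=> x _ a b ab; rewrite lee_wpmul2r ?lee_fin//; exact/lefP/nd_nnsfun_approx.
Qed.

End density.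

Section laws.
Local Open Scope ereal_scope.
Context {R : realType}.

(** Completing the square turns the integrand into a multiple of another Gaussian
    density. *)
Lemma normal_mgf (sigma r : R) : (0 < sigma)%R ->
  \int[normal_prob 0 sigma]_x (expR (r * x))%:E = (expR (r ^+ 2 * sigma ^+ 2 / 2))%:E.
Proof.
move=> s0; have sn0 : (sigma != 0)%R by rewrite gt_eqF.
rewrite (@ge0_integral_density _ _ _ lebesgue_measure _ (normal_pdf 0 sigma)) //.
- transitivity (\int[lebesgue_measure]_x ((expR (r ^+ 2 * sigma ^+ 2 / 2))%:E *
      (normal_pdf (r * sigma ^+ 2) sigma x)%:E)).
    apply: eq_integral => x _; rewrite -!EFinM; congr EFin.
    rewrite !normal_pdfE// mulrCA [RHS]mulrCA; congr (_ * _)%R.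
    rewrite /normal_fun -!expRD; congr expR; rewrite subr0.
    by field.
  rewrite ge0_integralZl//; last 2 first.
  - by apply/measurable_EFinP; exact: measurable_normal_pdf.
  - by move=> x _; rewrite lee_fin normal_pdf_ge0.
  by rewrite integral_normal_pdf mule1.
- exact: measurable_normal_pdf.
- by move=> x; exact: normal_pdf_ge0.
- by apply/measurable_EFinP; apply: measurableT_comp => //; apply: measurable_funM.
Qed.

Lemma exponential_tail (nu a : R) : (0 < nu)%R -> (0 < a)%R ->
  exponential_prob nu `[a, +oo[ = (expR (- nu * a))%:E.
Proof.
move=> nu0 a0.
rewrite /exponential_prob (@ge0_continuous_FTC2y _ _
  (fun x => - (expR (- nu * x))) a 0)%R.
- by rewrite EFinN oppeK add0e.
- by move=> x _; apply: exponential_pdf_ge0; exact: ltW.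
- apply: (@continuous_subspaceW R^o _ _ [set` `[0%R, +oo[]).
    by apply: subset_itvr; rewrite bnd_simp ltW.
  exact: within_continuous_exponential_pdf.
- rewrite -oppr0; apply: cvgN.
  rewrite (_ : (fun x => expR (- nu * x)) =
               (fun z => expR (- z)) \o (fun z => nu * z))%R; last first.
    by apply: eq_fun => x; rewrite mulNr.
  apply: (@cvg_comp _ _ _ _ _ _ (pinfty_nbhs R)); last exact: cvgr_expR.
  exact: gt0_cvgMry.
- by move=> x _; exact: ex_derive.
- apply: cvgN; apply/cvg_at_right_filter; apply: continuous_comp; last exact: continuous_expR.
  by apply: continuousM => //; apply: (@continuousN _ R^o); exact: cst_continuous.
- move=> x xa; apply: derive1_exponential_pdf; move: xa.
  by rewrite !in_itv/= !andbT; exact: lt_trans.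
Qed.

End laws.

(** * Increments of Brownian motion along a dyadic grid *)

Section independent_increments.
Local Open Scope ereal_scope.
Context d (T : measurableType d) (R : realType) (P : probability T R).
Variables (S : T -> R) (xi : nat -> T -> R) (gamma : probability R R).

Definition window (k n : nat) (B : nat -> set R) : set T :=
  [set w | forall i, (k <= i < n)%N -> B i (xi i w)].

Hypothesis blocks : forall k n B C, (k <= n)%N -> (forall i, measurable (B i)) ->
  measurable C -> P (window k n B `&` S @^-1` C) =
  (\prod_(k <= i < n) gamma (B i)) * P (S @^-1` C).

(** Normal form of the inductively generated events, to which the product rule for
    finitely many increments applies. *)
Lemma future_window k F : future S xi k F ->
  exists n B C, [/\ (k <= n)%N, forall i, measurable (B i), measurable C &
    F = window k n B `&` S @^-1` C].
Proof.
elim=> {k F} [k C mC|k A F mA _ [n [B [C [kn mB mC ->]]]]].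
  exists k, (fun=> setT), C; split => //.
  by apply/seteqP; split => [w Cw|w []//].
exists n, (fun i => if i == k then A else B i), C; split => //.
- exact: ltnW.
- by move=> i; case: ifP.
rewrite setIA; congr (_ `&` _); apply/seteqP; split => w.
  move=> [Aw Bw] i /andP[ki iN]; case: eqP => [->//|/eqP ik].
  by apply: Bw; rewrite iN andbT ltn_neqAle eq_sym ik.
move=> Bw; split; first by have := Bw k; rewrite eqxx leqnn kn; exact.
move=> i /andP[ki iN]; have := Bw i; rewrite iN (ltnW ki) gtn_eqF//; exact.
Qed.

Lemma windows_indep k B F : measurable B -> future S xi k.+1 F ->
  P (xi k @^-1` B `&` F) = gamma B * P F.
Proof.
move=> mB /future_window[n [B' [C [kn mB' mC ->]]]].
have -> : xi k @^-1` B `&` (window k.+1 n B' `&` S @^-1` C) =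
    window k n (fun i => if i == k then B else B' i) `&` S @^-1` C.
  rewrite setIA; congr (_ `&` _); apply/seteqP; split => w.
    move=> [Aw Bw] i /andP[ki iN]; case: eqP => [->//|/eqP ik].
    by apply: Bw; rewrite iN andbT ltn_neqAle eq_sym ik.
  move=> Bw; split; first by have := Bw k; rewrite eqxx leqnn kn; exact.
  move=> i /andP[ki iN]; have := Bw i; rewrite iN (ltnW ki) gtn_eqF//; exact.
rewrite !blocks//; last 2 first.
  exact: ltnW.
  by move=> i; case: ifP.
rewrite big_ltn// eqxx -muleA; congr (_ * (_ * _)).
by apply: eq_big_nat => i /andP[ki _]; rewrite gtn_eqF.
Qed.

End independent_increments.

Section brownian_increments.
Local Open Scope ereal_scope.
Context d (T : measurableType d) (R : realType) (P : probability T R).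
Variables (B : R -> T -> R) (mu : R) (S : T -> R).
Hypothesis hB : standard_brownian_motion P B.
Hypothesis hSW : independent_of_process P S (with_drift mu B).

Definition shift (m x : R) : R := (x + m)%R.

Lemma measurable_shift m : measurable_fun setT (shift m).
Proof. by apply: measurable_funD. Qed.

Let measurable_shiftR m :
  measurable_fun setT (shift m : measurableTypeR R -> R).
Proof. exact: measurable_shift. Qed.

Definition increment_law (h : R) : probability R R :=
  distribution (normal_prob 0 (Num.sqrt h))
    (HB.pack (shift (mu * h)) (isMeasurableFun.Build _ _ _ _ _ (measurable_shiftR (mu * h)))
      : {mfun measurableTypeR R >-> R}).

Lemma increment_mgf h r : (0 < h)%R ->
  \int[increment_law h]_x (expR (r * x))%:E =
  (expR (h * (r * mu + r ^+ 2 / 2)))%:E.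
Proof.
move=> h0; rewrite ge0_integral_distribution; last 2 first.
- by apply/measurable_EFinP; apply: measurableT_comp => //; apply: measurable_funM.
- by move=> x; rewrite lee_fin expR_ge0.
transitivity (\int[normal_prob 0 (Num.sqrt h)]_x
    ((expR (r * (mu * h)))%:E * (expR (r * x))%:E)).
  by apply: eq_integral => x _ /=; rewrite -EFinM -expRD /shift; congr (expR _)%:E; ring.
have mr : measurable_fun setT (fun x : measurableTypeR R => (expR (r * x))%:E).
  by apply/measurable_EFinP; apply: measurableT_comp => //; apply: measurable_funM.
rewrite ge0_integralZl ?lee_fin ?expR_ge0//.
rewrite normal_mgf ?sqrtr_gt0// -EFinM -expRD sqr_sqrtr ?ltW//.
by congr (expR _)%:E; ring.
Qed.

Section grid.
Variable n : nat.
Let W := with_drift mu B.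

Definition grid_increment k w : R := dincr (fun t => W t w) n k.

Lemma dyadicS k : (dyadic n k.+1 - dyadic n k = (2 ^+ n)^-1 :> R)%R.
Proof. by rewrite /dyadic -mulrBl -natr1 addrAC subrr add0r mul1r. Qed.

Lemma dyadic_ge0 k : (0 <= dyadic n k :> R)%R.
Proof. by rewrite divr_ge0// exprn_ge0. Qed.

Lemma measurable_drift t : (0 <= t)%R -> measurable_fun setT (W t).
Proof. by move=> t0; apply: measurable_funD => //; exact: (bm_measurable hB). Qed.

Lemma measurable_grid_increment k : measurable_fun setT (grid_increment k).
Proof. by apply: measurable_funB; apply: measurable_drift; exact: dyadic_ge0. Qed.

Lemma grid_incrementE k w : grid_increment k w =
  shift (mu * (2 ^+ n)^-1) (B (dyadic n k.+1) w - B (dyadic n k) w)%R.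
Proof.
by rewrite /grid_increment /dincr /W /with_drift /shift -(dyadicS k); ring.
Qed.

Lemma grid_increment_law k A : measurable A ->
  P (grid_increment k @^-1` A) = increment_law (2 ^+ n)^-1 A.
Proof.
move=> mA; have -> : grid_increment k @^-1` A =
   (fun w => B (dyadic n k.+1) w - B (dyadic n k) w)%R @^-1`
     (shift (mu * (2 ^+ n)^-1) @^-1` A).
  by apply/seteqP; split => w /=; rewrite grid_incrementE.
rewrite (bm_gaussian_increments hB).
- by rewrite dyadicS.
- exact: dyadic_ge0.
- by rewrite -subr_gt0 dyadicS invr_gt0 exprn_gt0.
- exact: measurable_preimageT (measurable_shift _) mA.
Qed.

Let generators : set (set T) :=
  \bigcup_(t in [set t | (0 <= t)%R]) preimage_set_system setT (W t) measurable.

(** Such an event is determined by the path at the grid times, which gives its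
    independence of the clock. *)
Lemma window_sigma_process k N A : (forall i, measurable (A i)) ->
  sigma_process W (window grid_increment k N A).
Proof.
move=> mA.
have mW t : (0 <= t)%R ->
    measurable_fun setT (W t : g_sigma_algebraType generators -> R).
  move=> t0 _ Y mY; apply: sub_sigma_algebra; exists t => //.
  by exists Y.
have mxi i : measurable_fun setT (grid_increment i : g_sigma_algebraType generators -> R).
  by apply: measurable_funB; apply: mW; exact: dyadic_ge0.
have -> : window grid_increment k N A =
    \bigcap_i (if (k <= i < N)%N then grid_increment i @^-1` A i else setT).
  apply/seteqP; split => w /= h i; first by move=> _; case: ifP => // /h.
  by move=> iN; have := h i I; rewrite iN.
apply: (@bigcapT_measurable _ (g_sigma_algebraType generators)) => i.
case: ifP => _ //; exact: measurable_preimageT (mxi i) (mA i).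
Qed.

Lemma grid_window k N A C : (k <= N)%N -> (forall i, measurable (A i)) ->
  measurable C -> P (window grid_increment k N A `&` S @^-1` C) =
  (\prod_(k <= i < N) increment_law (2 ^+ n)^-1 (A i)) * P (S @^-1` C).
Proof.
move=> kN mA mC; rewrite hSW; last 2 first.
- exact: window_sigma_process.
- by exists C => //; rewrite setTI.
congr (_ * _).
pose A' (i : 'I_N) := if (k <= i)%N then shift (mu * (2 ^+ n)^-1) @^-1` A i else setT.
have mA' i : measurable (A' i).
  by rewrite /A'; case: ifP => // _; exact: measurable_preimageT (measurable_shift _) (mA i).
have := bm_independent_increments hB (n := N) (t := dyadic n) (dyadic_ge0 0) _ mA'.
have -> : [set w | forall i : 'I_N, A' i (B (dyadic n i.+1) w - B (dyadic n i) w)%R] =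
    window grid_increment k N A.
  apply/seteqP; split => w /= h i.
    move=> /andP[ki iN]; have := h (Ordinal iN); rewrite /A' /= ki /=.
    by rewrite grid_incrementE.
  by rewrite /A'; case: ifP => // ki; have := h i; rewrite ki ltn_ord grid_incrementE; apply.
move=> ->; last first.
  by move=> i _; rewrite -subr_ge0 dyadicS invr_ge0 exprn_ge0.
rewrite -(big_mkord xpredT (fun i => P ((fun w => B (dyadic n i.+1) w - B (dyadic n i) w)%R @^-1`
   (if (k <= i)%N then shift (mu * (2 ^+ n)^-1) @^-1` A i else setT)))).
rewrite (@big_cat_nat _ _ _ k)//= big_nat big1 ?mul1e; last first.
  move=> i /andP[_ ik]; rewrite leqNgt ik /= preimage_setT; exact: probability_setT.
apply: eq_big_nat => i /andP[ki _]; rewrite ki.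
apply: (eq_trans _ (grid_increment_law i (mA i))).
by congr (P _); apply/seteqP; split => w /=; rewrite grid_incrementE.
Qed.

Lemma grid_indep k A F : measurable A -> future S grid_increment k.+1 F ->
  P (grid_increment k @^-1` A `&` F) = increment_law (2 ^+ n)^-1 A * P F.
Proof. by move=> mA FF; apply: (windows_indep grid_window). Qed.

End grid.
End brownian_increments.

(** * The exponential clock counted in grid steps *)

Section clock.
Local Open Scope ereal_scope.
Context d (T : measurableType d) (R : realType) (P : probability T R).
Variables (S : {RV P >-> R}) (nu : R).
Hypothesis nu0 : (0 < nu)%R.
Hypothesis hS : forall A, measurable A -> distribution P S A = exponential_prob nu A.

Definition ticks n (s : R) : nat := Num.truncn (s * 2 ^+ n).

Lemma ticks_gt n k : [set s | (k < ticks n s)%N] = `[dyadic n k.+1, +oo[%classic.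
Proof.
apply/seteqP; split => s /=; rewrite in_itv/= andbT /ticks truncn_gt_nat /dyadic;
  by rewrite ler_pdivrMr ?exprn_gt0.
Qed.

Lemma measurable_ticks n k : measurable [set s | (k < ticks n s)%N].
Proof. by rewrite ticks_gt. Qed.

Lemma ticks_geometric n k : P (S @^-1` [set s | (k < ticks n s)%N]) =
  (expR (- (nu / 2 ^+ n)) ^+ k.+1)%:E.
Proof.
rewrite ticks_gt -[LHS]/(distribution P S _) hS// exponential_tail//.
  by rewrite -expRM_natl; congr (expR _)%:E; rewrite /dyadic; ring.
by rewrite divr_gt0// exprn_gt0.
Qed.

End clock.

(** * Limit of the mean stopped total *)

Section small_time_moments.
Local Open Scope ereal_scope.
Context {R : realType}.

Lemma cvg_half_powers : ((2 ^+ n)^-1 : R)%R @[n --> \oo] --> (0 : R)%R.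
Proof.
under eq_cvg do rewrite -exprVn.
by apply: cvg_expr; rewrite ger0_norm ?invr_ge0// invf_lt1// ltr1n.
Qed.

Lemma cvg_expR_slope (a : R) (h : nat -> R) : (forall n, 0 < h n)%R ->
  h n @[n --> \oo] --> (0 : R)%R ->
  ((expR (h n * a) - 1) / h n)%R @[n --> \oo] --> a.
Proof.
move=> h0 ch.
have cha : (1 - h n * a)%R @[n --> \oo] --> (1 : R)%R.
  rewrite -[X in _ --> X]subr0 -(mul0r a); apply: cvgB; first exact: cvg_cst.
  by apply: cvgM => //; exact: cvg_cst.
apply: (squeeze_cvgr (f := fun=> a) (h := fun n => a / (1 - h n * a))%R).
- near=> n; have hn := h0 n.
  have d0 : (0 < 1 - h n * a)%R by near: n; exact: (cvgr_gt 1%R).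
  rewrite ler_pdivlMr// ler_pdivrMr//; apply/andP; split.
    by have := expR_ge1Dx (h n * a)%R; lra.
  have e1 := expR_ge1Dx (- (h n * a))%R.
  have e2 : (expR (h n * a) * (1 - h n * a) <= 1)%R.
    have := ler_wpM2l (expR_ge0 (h n * a)) e1.
    by rewrite -expRD subrr expR0.
  rewrite (mulrAC a) ler_pdivlMr//; lra.
- exact: cvg_cst.
- rewrite -[X in _ --> X]divr1; apply: cvgM; first exact: cvg_cst.
  by apply: cvgV => //; rewrite oner_neq0.
Unshelve. all: by end_near. Qed.

Variables (gamma : nat -> probability R R) (phi : R -> R) (h : nat -> R) (m p q : R).
Hypothesis mphi : measurable_fun setT phi.
Hypothesis h0 : forall n, (0 < h n)%R.
Hypothesis ch : h n @[n --> \oo] --> (0 : R)%R.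
Hypothesis mgf : forall n r, \int[gamma n]_x (expR (r * phi x))%:E =
  (expR (h n * (r * m + r ^+ 2 / 2)))%:E.

Let kap := (p + q)%R.

(** Coefficients and rates of the exponentials in the expansion of
    [(expR (kap * y) - 1) ^+ 4 + (expR (- kap * y) - 1) ^+ 4]. *)
Definition quartic : seq (R * R) :=
  [:: (1, 4 * kap); (-4, 3 * kap); (6, 2 * kap); (-4, kap); (2, 0);
      (-4, - kap); (6, - (2 * kap)); (-4, - (3 * kap)); (1, - (4 * kap))]%R.

Definition quartic_moment n : R :=
  (\sum_(l <- quartic) l.1 * expR (h n * (l.2 * m + l.2 ^+ 2 / 2)))%R.

Lemma fourth_order_quartic x : fourth_order phi p q x =
  (\sum_(l <- quartic) l.1 * expR (l.2 * phi x))%R.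
Proof.
rewrite /quartic !big_cons big_nil /= /fourth_order -/kap.
have e (k : nat) (s : R) : (expR (k%:R * s * phi x) = expR (s * phi x) ^+ k)%R.
  by rewrite -mulrA expRM_natl.
rewrite -(mulrN 2) -(mulrN 3) -(mulrN 4) !e mul0r expR0.
by ring.
Qed.

Let integrable_exp n r : (gamma n).-integrable setT (fun x => (expR (r * phi x))%:E).
Proof.
apply/integrableP; split.
  by apply/measurable_EFinP; apply: measurableT_comp => //; apply: measurable_funM.
under eq_integral do rewrite /= ger0_norm ?expR_ge0//.
by rewrite mgf ltry.
Qed.

Lemma fourth_moment_quartic n :
  \int[gamma n]_x (fourth_order phi p q x)%:E = (quartic_moment n)%:E.
Proof.
under eq_integral do rewrite fourth_order_quartic -sumEFin.
rewrite integral_sum//; last first.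
  move=> l; under eq_fun do rewrite EFinM.
  by apply: (@integrableZl _ _ _ _ _ measurableT); exact: integrable_exp.
rewrite /quartic_moment -sumEFin; apply: eq_bigr => l _.
under eq_integral do rewrite EFinM.
by rewrite (integralZl measurableT (integrable_exp n l.2)) mgf -EFinM.
Qed.

Lemma quartic_moment_ge0 n : (0 <= quartic_moment n)%R.
Proof.
rewrite -lee_fin -fourth_moment_quartic.
by apply: integral_ge0 => x _; rewrite lee_fin fourth_order_ge0.
Qed.

(** The coefficients of [quartic] sum to 0, and so do their products with the
    first order terms [l.2 * m + l.2 ^+ 2 / 2] of the moments: a fourth
    difference annihilates quadratic polynomials. *)
Lemma quartic_moment_small : (quartic_moment n / h n)%R @[n --> \oo] --> (0 : R)%R.
Proof.
have E n : (quartic_moment n / h n =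
   \sum_(l <- quartic) l.1 * ((expR (h n * (l.2 * m + l.2 ^+ 2 / 2)) - 1) / h n))%R.
  rewrite /quartic_moment /quartic !big_cons !big_nil /=.
  by have := h0 n => ?; field; rewrite gt_eqF.
have lim0 : (\sum_(l <- quartic) l.1 * (l.2 * m + l.2 ^+ 2 / 2))%R = 0%R.
  by rewrite /quartic !big_cons big_nil /=; field.
rewrite -[X in _ --> X]lim0; under eq_cvg do rewrite E.
apply: cvg_big => [|l _]; first exact: add_continuous.
by apply: cvgM; [exact: cvg_cst|exact: cvg_expR_slope].
Qed.

End small_time_moments.

Section mean_limit.
Local Open Scope ereal_scope.
Context d (T : measurableType d) (R : realType) (P : probability T R).
Variables (B : R -> T -> R) (mu c nu : R) (S : {RV P >-> R}).
Hypothesis hB : standard_brownian_motion P B.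
Hypotheses (c0 : (0 < c)%R) (nu0 : (0 < nu)%R).
Hypothesis hS : forall A, measurable A -> distribution P S A = exponential_prob nu A.
Hypothesis hSW : independent_of_process P S (with_drift mu B).

Definition grid_mean phi n : \bar R :=
  mean_ups P S (grid_increment B mu n) (ticks n) c phi.

Variables (phi : R -> R) (m : R).
Hypothesis mphi : measurable_fun setT phi.
Hypothesis mgf : forall h r, (0 < h)%R ->
  \int[increment_law mu h]_x (expR (r * phi x))%:E =
  (expR (h * (r * m + r ^+ 2 / 2)))%:E.

(* A, B0 and A', B' solve the slope conditions at 0 and c. *)
Let delta := Num.sqrt (m ^+ 2 + 2 * nu).
Let p := (delta - m)%R.
Let q := (delta + m)%R.
Let Delta := (expR (p * c) - expR (- q * c))%R.
Let A := ((p * Delta)^-1)%R.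
Let B0 := ((q * Delta)^-1)%R.
Let A' := ((1 + expR (- q * c)) / (p * Delta))%R.
Let B' := ((1 + expR (p * c)) / (q * Delta))%R.
Let rho n : R := expR (- (nu / 2 ^+ n)).

Let delta2 : (delta ^+ 2 = m ^+ 2 + 2 * nu)%R.
Proof. by rewrite sqr_sqrtr// addr_ge0 ?sqr_ge0// mulr_ge0// ltW. Qed.

Let abs_m_lt_delta : (`|m| < delta)%R.
Proof.
rewrite -sqrtr_sqr ltr_sqrt ?ltrDl ?mulr_gt0//.
by rewrite ltr_pwDr ?sqr_ge0// mulr_gt0.
Qed.

Let p0 : (0 < p)%R.
Proof. by rewrite subr_gt0; apply: le_lt_trans abs_m_lt_delta; exact: ler_norm. Qed.

Let q0 : (0 < q)%R.
Proof.
have := abs_m_lt_delta; have := ler_norm (- m)%R; rewrite normrN /q; lra.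
Qed.

Let Delta0 : (0 < Delta)%R.
Proof.
rewrite subr_gt0 ltr_expR mulNr (@lt_trans _ _ 0%R)//.
  by rewrite oppr_lt0 mulr_gt0.
by rewrite mulr_gt0.
Qed.

Let h0 n : (0 < (2 ^+ n)^-1 :> R)%R. Proof. by rewrite invr_gt0 exprn_gt0. Qed.

Let rho01 n : (0 < rho n < 1)%R.
Proof.
rewrite expR_gt0 -expR0 ltr_expR oppr_lt0 divr_gt0// exprn_gt0//.
Qed.

Let mgf_p n : \int[increment_law mu (2 ^+ n)^-1]_x (expR (p * phi x))%:E = ((rho n)^-1)%:E.
Proof.
rewrite mgf// /rho -expRN opprK; congr (expR _)%:E.
have -> : (p * m + p ^+ 2 / 2 = nu)%R.
  have -> : (p * m + p ^+ 2 / 2 = (delta ^+ 2 - m ^+ 2) / 2)%R by rewrite /p; field.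
  by rewrite delta2; field.
by rewrite mulrC.
Qed.

Let mgf_q n : \int[increment_law mu (2 ^+ n)^-1]_x (expR (- q * phi x))%:E = ((rho n)^-1)%:E.
Proof.
rewrite mgf// /rho -expRN opprK; congr (expR _)%:E.
have -> : (- q * m + (- q) ^+ 2 / 2 = nu)%R.
  have -> : (- q * m + (- q) ^+ 2 / 2 = (delta ^+ 2 - m ^+ 2) / 2)%R by rewrite /q; field.
  by rewrite delta2; field.
by rewrite mulrC.
Qed.

(** The value at 0 of the test function with slopes 0 and 1. *)
Definition mean_limit : R := expR (m * c) * V c m nu / (2 * nu).

Let test_fun0 : test_fun p q A B0 0 = mean_limit.
Proof.
rewrite /test_fun !mulr0 expR0 !mulr1 /mean_limit /V -/delta /Defs.sinh /A /B0.
have DE : Delta = (expR (- m * c) * (expR (c * delta) - expR (- (c * delta))))%R.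
  by rewrite /Delta mulrBr -!expRD /p /q; congr (expR _ - expR _)%R; ring.
have := Delta0; rewrite DE => D0.
have pq : (p * q = 2 * nu)%R.
  have -> : (p * q = delta ^+ 2 - m ^+ 2)%R by rewrite /p /q; ring.
  by rewrite delta2; ring.
have e0 : (expR (m * c) * expR (- m * c) = 1)%R by rewrite -expRD mulNr subrr expR0.
have em : expR (- m * c) != 0%R by rewrite gt_eqF// expR_gt0.
have s0 : (expR (c * delta) - expR (- (c * delta)))%R != 0%R.
  by apply: contraTneq D0 => ->; rewrite mulr0 ltxx.
have pn : p != 0%R by rewrite gt_eqF.
have qn : q != 0%R by rewrite gt_eqF.
have -> : expR (m * c) = (expR (- m * c))^-1%R by rewrite -expRN mulNr opprK.
have -> : (2 * nu = p * q)%R by [].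
have -> : delta = ((p + q) / 2)%R by rewrite /p /q; field.
have s0' : (expR (c * ((p + q) / 2)) - expR (- (c * ((p + q) / 2))))%R != 0%R.
  by have <- : delta = ((p + q) / 2)%R by rewrite /p /q; field.
by field; rewrite pn qn em s0'.
Qed.

Let pDelta : (0 < p * Delta)%R. Proof. by rewrite mulr_gt0. Qed.
Let qDelta : (0 < q * Delta)%R. Proof. by rewrite mulr_gt0. Qed.

Let A_ge0 : (0 <= A)%R. Proof. by rewrite invr_ge0 ltW. Qed.
Let B_ge0 : (0 <= B0)%R. Proof. by rewrite invr_ge0 ltW. Qed.
Let A'_ge0 : (0 <= A')%R.
Proof. by rewrite divr_ge0 ?addr_ge0 ?expR_ge0// ltW. Qed.
Let B'_ge0 : (0 <= B')%R.
Proof. by rewrite divr_ge0 ?addr_ge0 ?expR_ge0// ltW. Qed.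

Let nz : [/\ p != 0, q != 0 & Delta != 0]%R.
Proof. by split; rewrite gt_eqF. Qed.

Let slope0 : (q * B0 - p * A = 0)%R.
Proof. by have [pn qn Dn] := nz; rewrite /A /B0; field; rewrite pn qn Dn. Qed.

Let slopec : (p * (A * expR (p * c)) - q * (B0 * expR (- q * c)) = 1)%R.
Proof.
have [pn qn Dn] := nz; rewrite /A /B0.
transitivity (Delta / Delta)%R; last by rewrite divff.
by rewrite {3}/Delta; field; rewrite pn qn Dn.
Qed.

Let slope0' : (q * B' - p * A' = 1)%R.
Proof.
have [pn qn Dn] := nz; rewrite /A' /B'.
transitivity (Delta / Delta)%R; last by rewrite divff.
by rewrite {3}/Delta; field; rewrite pn qn Dn.
Qed.

Let slopec' : (p * (A' * expR (p * c)) - q * (B' * expR (- q * c)) = 1)%R.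
Proof.
have [pn qn Dn] := nz; rewrite /A' /B'.
transitivity (Delta / Delta)%R; last by rewrite divff.
by rewrite {3}/Delta; field; rewrite pn qn Dn.
Qed.

Let mS : measurable_fun setT S. Proof. exact: measurable_funPT. Qed.

Lemma grid_mean_le n : grid_mean phi n <= mean_limit%:E.
Proof.
rewrite -test_fun0.
exact: (mean_ups_le mS (measurable_grid_increment mu hB n)
  (grid_indep hB hSW (n := n)) (measurable_ticks n) c0 (rho01 n)
  (ticks_geometric nu0 hS n) mphi p0 q0 (mgf_p n) (mgf_q n)
  A_ge0 B_ge0 slope0 slopec).
Qed.

Lemma grid_mean_ge0 n : 0 <= grid_mean phi n.
Proof. by apply: integral_ge0 => w _; rewrite lee_fin ups_of_ge0. Qed.

Let K := (A * expR (p * c) + B0)%R.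
Let G := test_fun p q A' B' 0.
Let M n := quartic_moment (fun n => (2 ^+ n)^-1)%R m p q n.

Let grid_mean_ge n eps : (0 < eps)%R ->
  mean_limit%:E <= grid_mean phi n +
    (K * ((p + q) * eps * G + M n * (rho n / (1 - rho n)) / eps ^+ 2))%:E.
Proof.
move=> eps0; rewrite -test_fun0.
apply: (mean_ups_ge mS (measurable_grid_increment mu hB n)
  (grid_indep hB hSW (n := n)) (measurable_ticks n) c0 (rho01 n)
  (ticks_geometric nu0 hS n) mphi p0 q0 (mgf_p n) (mgf_q n)
  A_ge0 B_ge0 slope0 slopec A'_ge0 B'_ge0 slope0' slopec' eps0).
rewrite (@fourth_moment_quartic _ (fun n => increment_law mu (2 ^+ n)^-1) phi
  (fun n => (2 ^+ n)^-1)%R m p q)//.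
by move=> k r; exact: mgf.
Qed.

(* rho / (1 - rho) is at most 2 ^ n / nu, so that a moment which is negligible
   with respect to the time step is enough. *)
Let correction_small : (M n * (rho n / (1 - rho n)))%R @[n --> \oo] --> (0 : R)%R.
Proof.
have M0 n : (0 <= M n)%R.
  apply: (@quartic_moment_ge0 _ (fun n => increment_law mu (2 ^+ n)^-1) phi) => //.
  by move=> k r; exact: mgf.
apply: (squeeze_cvgr (f := fun=> 0%R) (h := fun n => (M n / (2 ^+ n)^-1 * nu^-1)%R)).
- apply: nearW => n; have /andP[r0 r1] := rho01 n.
  rewrite mulr_ge0 ?divr_ge0 ?subr_ge0 ?(ltW r0) ?(ltW r1)//=.
  rewrite -mulrA ler_wpM2l// -invfM ler_pdivrMr ?subr_gt0// mulrC ler_pdivlMr ?mulr_gt0//.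
  have := expR_ge1Dx (nu / 2 ^+ n); have := ltW r0; set x := (nu / 2 ^+ n)%R => r0' /(ler_wpM2l r0').
  rewrite {2}/rho -expRD addNr expR0 -/x mulrDr mulr1 => h.
  by rewrite [(_^-1 * nu)%R]mulrC -/x; lra.
- exact: cvg_cst.
- rewrite -(mul0r nu^-1)%R; apply: cvgM; last exact: cvg_cst.
  apply: quartic_moment_small => //; exact: cvg_half_powers.
Qed.

Lemma grid_mean_cvg : grid_mean phi n @[n --> \oo] --> mean_limit%:E.
Proof.
have fin n : grid_mean phi n \is a fin_num.
  by rewrite ge0_fin_numE ?grid_mean_ge0// (le_lt_trans (grid_mean_le n))// ltry.
suff : fine (grid_mean phi n) @[n --> \oo] --> mean_limit.
  by move=> cv; apply/fine_cvgP; split => //; exact: nearW.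
have K0 : (0 <= K)%R by rewrite addr_ge0// mulr_ge0// expR_ge0.
have G0 : (0 <= G)%R by rewrite test_fun_ge0.
apply/cvgrPdist_le => e e0.
(* eps makes the first order error at most e / 2, for every n; the summand 1
   keeps the denominators C and K + 1 positive. *)
pose C := (K * ((p + q) * G) + 1)%R.
have C0 : (0 < C)%R by rewrite ltr_wpDl// !mulr_ge0// addr_ge0 ?ltW.
pose eps := (e / 2 / C)%R.
have eps0 : (0 < eps)%R by rewrite !divr_gt0.
have eps20 : (0 < eps ^+ 2)%R by rewrite exprn_gt0.
pose r := (e / 2 / (K + 1) * eps ^+ 2)%R.
have r0 : (0 < r)%R by rewrite mulr_gt0// !divr_gt0// ltr_wpDl.
near=> n.
have corr : (M n * (rho n / (1 - rho n)) <= r)%R.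
  by near: n; exact: (cvgr_le 0%R).
have := grid_mean_ge n eps0; have := grid_mean_le n.
rewrite -(fineK (fin n)) -EFinD !lee_fin => le1 le2.
rewrite ger0_norm ?subr_ge0//.
have k1 : (K * ((p + q) * eps * G) <= e / 2)%R.
  have -> : (K * ((p + q) * eps * G) = (K * ((p + q) * G)) * eps)%R by ring.
  have -> : (e / 2 = C * eps)%R by rewrite /eps; field; rewrite gt_eqF.
  by rewrite ler_wpM2r ?(ltW eps0)// /C lerDl.
have k2 : (K * (M n * (rho n / (1 - rho n)) / eps ^+ 2) <= e / 2)%R.
  apply: (@le_trans _ _ (K * (e / 2 / (K + 1)))%R).
    by rewrite ler_wpM2l// ler_pdivrMr.
  rewrite mulrA ler_pdivrMr ?ltr_wpDl// mulrC ler_wpM2l ?divr_ge0 ?(ltW e0)//.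
  by rewrite lerDl.
rewrite lerBlDl; apply: (le_trans le2); rewrite lerD2l mulrDr; lra.
Unshelve. all: by end_near. Qed.

End mean_limit.

(** * Increasing limits of random variables with bounded means *)

Section monotone_limits.
Local Open Scope ereal_scope.
Context d (T : measurableType d) (R : realType) (P : probability T R).
Implicit Types (g h : nat -> T -> R) (L : R).

Definition sup_limit g (w : T) : R := fine (ereal_sup (range (fun n => (g n w)%:E))).

Section one_sequence.
Variables (g : nat -> T -> R) (L : R).
Hypothesis mg : forall n, measurable_fun setT (g n).
Hypothesis g0 : forall n w, (0 <= g n w)%R.
Hypothesis gS : forall n w, (g n w <= g n.+1 w)%R.

Let esup w := ereal_sup (range (fun n => (g n w)%:E)).

Let cvg_esup w : (g n w)%:E @[n --> \oo] --> esup w.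
Proof.
by apply: ereal_nondecreasing_cvgn; apply/nondecreasing_seqP => n; rewrite lee_fin.
Qed.

Let esup_ge0 w : 0 <= esup w.
Proof. by apply: le_ereal_sup_tmp; exists (g 0%N w)%:E; [exists 0%N|rewrite lee_fin]. Qed.

Let measurable_esup : measurable_fun setT esup.
Proof.
apply: (emeasurable_fun_cvg (fun n w => (g n w)%:E)) => [n|w _].
  exact/measurable_EFinP.
exact: cvg_esup.
Qed.

Lemma sup_limit_ge0 w : (0 <= sup_limit g w)%R.
Proof. by apply: fine_ge0; exact: esup_ge0. Qed.

Lemma measurable_sup_limit : measurable_fun setT (sup_limit g).
Proof. exact: measurableT_comp (fine_measurable measurableT) measurable_esup. Qed.

Lemma cvg_sup_limit w : ereal_sup (range (fun n => (g n w)%:E)) \is a fin_num ->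
  g n w @[n --> \oo] --> sup_limit g w.
Proof.
move=> fw; have : (g n w)%:E @[n --> \oo] --> (sup_limit g w)%:E.
  by rewrite /sup_limit fineK//; exact: cvg_esup.
by move=> /fine_cvgP[].
Qed.

Hypothesis limL : \int[P]_w (g n w)%:E @[n --> \oo] --> L%:E.

Let integral_esup : \int[P]_w esup w = L%:E.
Proof.
have -> : esup = fun w => limn (fun n => (g n w)%:E).
  by apply/funext => w; apply/esym/cvg_lim => //; exact: cvg_esup.
rewrite monotone_convergence//; first exact: cvg_lim.
- by move=> n; exact/measurable_EFinP.
- by move=> n w _; rewrite lee_fin.
- move=> w _; apply/nondecreasing_seqP => n; rewrite lee_fin; exact: gS.
Qed.

Lemma sup_limit_fin_num :
  {ae P, forall w, ereal_sup (range (fun n => (g n w)%:E)) \is a fin_num}.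
Proof.
have : P.-integrable setT esup.
  apply/integrableP; split => //.
  under eq_integral do rewrite gee0_abs//.
  by rewrite integral_esup ltry.
by move=> /(integrable_ae measurableT); apply: filterS => w; apply.
Qed.

Lemma integral_sup_limit : \int[P]_w (sup_limit g w)%:E = L%:E.
Proof.
rewrite -integral_esup; apply: ge0_ae_eq_integral => //.
- by apply/measurable_EFinP; exact: measurable_sup_limit.
- by move=> w _; rewrite lee_fin sup_limit_ge0.
- by apply: filterS sup_limit_fin_num => w fw _; rewrite /sup_limit fineK.
Qed.

End one_sequence.

(** The extended suprema are almost surely finite, and there the finite parts of
    the limits multiply. *)
Lemma integral_sup_limit_product g h (Lg Lh L : R) :
  (forall n, measurable_fun setT (g n)) -> (forall n, measurable_fun setT (h n)) ->
  (forall n w, (0 <= g n w)%R) -> (forall n w, (0 <= h n w)%R) ->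
  (forall n w, (g n w <= g n.+1 w)%R) -> (forall n w, (h n w <= h n.+1 w)%R) ->
  \int[P]_w (g n w)%:E @[n --> \oo] --> Lg%:E ->
  \int[P]_w (h n w)%:E @[n --> \oo] --> Lh%:E ->
  \int[P]_w (g n w * h n w)%:E @[n --> \oo] --> L%:E ->
  \int[P]_w (sup_limit g w * sup_limit h w)%:E = L%:E.
Proof.
move=> mg mh g0 h0 gS hS cg ch cgh.
pose k n w := (g n w * h n w)%R.
have mk n : measurable_fun setT (k n) by exact: measurable_funM.
have k0 n w : (0 <= k n w)%R by rewrite mulr_ge0.
have kS n w : (k n w <= k n.+1 w)%R by rewrite ler_pM.
rewrite -(integral_sup_limit mk k0 kS cgh); apply: ge0_ae_eq_integral => //.
- apply/measurable_EFinP; apply: measurable_funM; exact: measurable_sup_limit.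
- by apply/measurable_EFinP; exact: measurable_sup_limit.
- by move=> w _; rewrite lee_fin mulr_ge0// sup_limit_ge0.
- by move=> w _; rewrite lee_fin sup_limit_ge0.
have fg := sup_limit_fin_num mg g0 gS cg.
have fh := sup_limit_fin_num mh h0 hS ch.
have fk := sup_limit_fin_num mk k0 kS cgh.
apply: filterS3 fg fh fk => w fg fh fk _; congr EFin.
have c1 : k n w @[n --> \oo] --> (sup_limit g w * sup_limit h w)%R.
  by apply: cvgM; exact: cvg_sup_limit.
have c2 := cvg_sup_limit kS fk.
by rewrite -(cvg_lim _ c1)// -(cvg_lim _ c2).
Qed.

End monotone_limits.

(** * Expectations of the truncated variations at the exponential time *)

Section sampled_variations.
Local Open Scope ereal_scope.
Context d (T : measurableType d) (R : realType) (P : probability T R).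
Variables (B : R -> T -> R) (mu c nu : R) (S : {RV P >-> R}).
Hypothesis hB : standard_brownian_motion P B.
Hypotheses (c0 : (0 < c)%R) (nu0 : (0 < nu)%R).
Hypothesis hS : forall A, measurable A -> distribution P S A = exponential_prob nu A.
Hypothesis hSW : independent_of_process P S (with_drift mu B).

Let W := with_drift mu B.
Let U w := UTV c (fun t => W t w) (S w).
Let D w := DTV c (fun t => W t w) (S w).

Definition sampled_ups phi n w : R :=
  ups_of (grid_increment B mu n) c phi (ticks n (S w)) w.

Let up_seq := sampled_ups (fun x => x).
Let down_seq := sampled_ups (fun x => - x)%R.

Lemma continuous_drift w : {within `[0%R, +oo[, continuous (fun t => W t w)}.
Proof.
have cB : {within `[0%R, +oo[, continuous (fun t => B t w)} by exact: bm_continuous hB _.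
move=> t; apply: cvgD; first exact: cB.
apply: continuous_subspaceT => {}t.
by apply: cvgM; [exact: cvg_cst|exact: cvg_id].
Qed.

Let up_seqE n w : up_seq n w = dUTV c (fun t => W t w) (S w) n.
Proof. by []. Qed.

Let down_seqE n w : down_seq n w = dUTV c (\- (fun t => W t w))%R (S w) n.
Proof.
rewrite /down_seq /sampled_ups /ups_of /dUTV; apply: eq_bigr => i _.
rewrite /up_of; congr (up c _ _); apply/funext => k.
by rewrite /grid_increment /dincr /= opprB opprK addrC.
Qed.

Lemma UTV_sup_limit : U = sup_limit up_seq.
Proof.
by apply/funext => w; rewrite /U UTV_ereal_sup//; exact: continuous_drift.
Qed.

Lemma DTV_sup_limit : D = sup_limit down_seq.
Proof.
apply/funext => w; rewrite /D DTV_UTV UTV_ereal_sup//; last first.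
  have cW := @continuous_drift w.
  by move=> t; apply: cvgN; exact: cW.
have -> : (fun n => (dUTV c (\- (fun t => W t w))%R (S w) n)%:E) =
    (fun n => (down_seq n w)%:E) by apply/funext => n; rewrite down_seqE.
by [].
Qed.

Let up_seq0 n w : (0 <= up_seq n w)%R. Proof. exact: ups_of_ge0. Qed.
Let down_seq0 n w : (0 <= down_seq n w)%R. Proof. exact: ups_of_ge0. Qed.

Let up_seqS n w : (up_seq n w <= up_seq n.+1 w)%R.
Proof. by rewrite !up_seqE; exact: dUTV_nondecreasing. Qed.
Let down_seqS n w : (down_seq n w <= down_seq n.+1 w)%R.
Proof. by rewrite !down_seqE; exact: dUTV_nondecreasing. Qed.

Let mS : measurable_fun setT S. Proof. exact: measurable_funPT. Qed.

Let mid : measurable_fun setT (fun x : R => x). Proof. by []. Qed.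
Let mopp : measurable_fun setT (fun x : R => - x)%R. Proof. exact: measurableT_comp. Qed.

Lemma measurable_sampled_ups phi n : measurable_fun setT phi ->
  measurable_fun setT (sampled_ups phi n).
Proof.
move=> mphi; apply: (measurable_clocked_sum mS (measurable_ticks n)
  (a := up_of (grid_increment B mu n) c phi)).
  by move=> k w; exact: up_of_ge0.
by move=> k; apply: measurable_up_of => // i; exact: (measurable_grid_increment mu hB n).
Qed.

Let mgf_id h r : (0 < h)%R -> \int[increment_law mu h]_x (expR (r * x))%:E =
  (expR (h * (r * mu + r ^+ 2 / 2)))%:E.
Proof. exact: increment_mgf. Qed.

Let mgf_opp h r : (0 < h)%R -> \int[increment_law mu h]_x (expR (r * - x))%:E =
  (expR (h * (r * - mu + r ^+ 2 / 2)))%:E.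
Proof.
move=> h0; under eq_integral do rewrite mulrN -mulNr.
by rewrite increment_mgf//; congr (expR _)%:E; ring.
Qed.

Let Lu := mean_limit c nu mu.
Let Ld := mean_limit c nu (- mu).

Let cvg_up : \int[P]_w (up_seq n w)%:E @[n --> \oo] --> Lu%:E.
Proof. exact: (grid_mean_cvg hB c0 nu0 hS hSW mid mgf_id). Qed.

Let cvg_down : \int[P]_w (down_seq n w)%:E @[n --> \oo] --> Ld%:E.
Proof. exact: (grid_mean_cvg hB c0 nu0 hS hSW mopp mgf_opp). Qed.

Let cvg_product :
  \int[P]_w (up_seq n w * down_seq n w)%:E @[n --> \oo] --> (2 * (Lu * Ld))%:E.
Proof.
have fin (phi : R -> R) (m : R) n : measurable_fun setT phi -> (forall h r, (0 < h)%R ->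
    \int[increment_law mu h]_x (expR (r * phi x))%:E =
    (expR (h * (r * m + r ^+ 2 / 2)))%:E) ->
    mean_ups P S (grid_increment B mu n) (ticks n) c phi < +oo.
  move=> mphi mgf.
  exact: le_lt_trans (grid_mean_le hB c0 nu0 hS hSW mphi mgf n) (ltry _).
have E n : \int[P]_w (up_seq n w * down_seq n w)%:E =
    2%:E * (\int[P]_w (up_seq n w)%:E * \int[P]_w (down_seq n w)%:E).
  have /andP[r0 _] : (0 < expR (- (nu / 2 ^+ n)) < 1)%R.
    by rewrite expR_gt0 -expR0 ltr_expR oppr_lt0 divr_gt0// exprn_gt0.
  apply: (mean_ups_product mS (measurable_grid_increment mu hB n)
    (grid_indep hB hSW (n := n)) (measurable_ticks n) (ltW r0)
    (ticks_geometric nu0 hS n) c0 mid mopp) => //.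
    exact: fin mid mgf_id.
  exact: fin mopp mgf_opp.
have -> : (fun n => \int[P]_w (up_seq n w * down_seq n w)%:E) =
    (fun n => 2%:E * (\int[P]_w (up_seq n w)%:E * \int[P]_w (down_seq n w)%:E)).
  exact/funext.
rewrite EFinM [(Lu * Ld)%:E]EFinM; apply: cvgeZl => //.
by apply: cvgeM.
Qed.

Lemma expectation_UTV : \int[P]_w (U w)%:E = Lu%:E.
Proof.
rewrite UTV_sup_limit; apply: integral_sup_limit => //.
by move=> n; exact: measurable_sampled_ups.
Qed.

Lemma expectation_DTV : \int[P]_w (D w)%:E = Ld%:E.
Proof.
rewrite DTV_sup_limit; apply: integral_sup_limit => //.
by move=> n; exact: measurable_sampled_ups.
Qed.

Lemma expectation_UTV_DTV : \int[P]_w (U w * D w)%:E = (2 * (Lu * Ld))%:E.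
Proof.
rewrite UTV_sup_limit DTV_sup_limit.
by apply: (integral_sup_limit_product _ _ _ _ _ _ cvg_up cvg_down cvg_product) => // n;
  exact: measurable_sampled_ups.
Qed.

Lemma UTV_sampled_ge0 w : (0 <= U w)%R.
Proof. by rewrite UTV_sup_limit sup_limit_ge0. Qed.

Lemma DTV_sampled_ge0 w : (0 <= D w)%R.
Proof. by rewrite DTV_sup_limit sup_limit_ge0. Qed.

Let ge0_integrable (f : T -> R) L : measurable_fun setT f -> (forall w, (0 <= f w)%R) ->
  \int[P]_w (f w)%:E = L%:E -> P.-integrable setT (EFin \o f).
Proof.
move=> mf f0 fL; apply/integrableP; split; first exact/measurable_EFinP.
under eq_integral do rewrite /= ger0_norm//.
by rewrite fL ltry.
Qed.

Lemma measurable_UTV : measurable_fun setT U.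
Proof.
rewrite UTV_sup_limit; apply: measurable_sup_limit => // n.
exact: measurable_sampled_ups.
Qed.

Lemma measurable_DTV : measurable_fun setT D.
Proof.
rewrite DTV_sup_limit; apply: measurable_sup_limit => // n.
exact: measurable_sampled_ups.
Qed.

Lemma integrable_UTV : P.-integrable setT (EFin \o U).
Proof. exact: ge0_integrable measurable_UTV UTV_sampled_ge0 expectation_UTV. Qed.

Lemma integrable_DTV : P.-integrable setT (EFin \o D).
Proof. exact: ge0_integrable measurable_DTV DTV_sampled_ge0 expectation_DTV. Qed.

Lemma integrable_UTV_DTV : P.-integrable setT (EFin \o (U * D)%R).
Proof.
apply: ge0_integrable expectation_UTV_DTV.
  by apply: measurable_funM; [exact: measurable_UTV|exact: measurable_DTV].
by move=> w; rewrite mulr_ge0 ?UTV_sampled_ge0 ?DTV_sampled_ge0.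
Qed.

Lemma mean_limit_product : (Lu * Ld = V c mu nu ^+ 2 / (4 * nu ^+ 2))%R.
Proof.
rewrite /Lu /Ld /mean_limit.
have -> : V c (- mu) nu = V c mu nu by rewrite /V sqrrN.
have e : (expR (mu * c) * expR (- mu * c) = 1)%R by rewrite -expRD mulNr subrr expR0.
transitivity ((expR (mu * c) * expR (- mu * c)) * (V c mu nu ^+ 2 / (4 * nu ^+ 2)))%R.
  by field; rewrite gt_eqF.
by rewrite e mul1r.
Qed.

End sampled_variations.

Theorem mainTheorem7 (d : measure_display) (T : measurableType d) (R : realType)
    (P : probability T R) (B : R -> T -> R) (mu c nu : R) (S : {RV P >-> R})
    (hB : standard_brownian_motion P B)
    (hc : 0 < c) (hnu : 0 < nu)
    (hS : forall A : set R, measurable A -> distribution P S A = exponential_prob nu A)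
    (hSW : independent_of_process P S (with_drift mu B)) :
  let W := with_drift mu B in
  let U := fun w : T => UTV c (fun t => W t w) (S w) in
  let D := fun w : T => DTV c (fun t => W t w) (S w) in
  [/\ P.-integrable setT (EFin \o U),
      P.-integrable setT (EFin \o D) &
      P.-integrable setT (EFin \o (U * D))] /\
  [/\ ('E_P[U * D])%E = (V c mu nu ^+ 2 / (2 * nu ^+ 2))%:E,
      covariance P U D = (V c mu nu ^+ 2 / (4 * nu ^+ 2))%:E,
      V c mu nu ^+ 2 / (4 * nu ^+ 2) =
        (mu ^+ 2 + 2 * nu) /
        (4 * nu ^+ 2 * sinh (c * Num.sqrt (mu ^+ 2 + 2 * nu)) ^+ 2) &
      0 < (mu ^+ 2 + 2 * nu) /
        (4 * nu ^+ 2 * sinh (c * Num.sqrt (mu ^+ 2 + 2 * nu)) ^+ 2)].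
Proof.
move=> W U D.
have iU := integrable_UTV hB hc hnu hS hSW; have iD := integrable_DTV hB hc hnu hS hSW.
have iUD := integrable_UTV_DTV hB hc hnu hS hSW.
split; first by split.
have EU := expectation_UTV hB hc hnu hS hSW; have ED := expectation_DTV hB hc hnu hS hSW.
have EUD := expectation_UTV_DTV hB hc hnu hS hSW.
have LL := mean_limit_product mu c hnu.
have half : 2 * (V c mu nu ^+ 2 / (4 * nu ^+ 2)) = V c mu nu ^+ 2 / (2 * nu ^+ 2).
  by field; rewrite gt_eqF.
have q0 : 0 < mu ^+ 2 + 2 * nu by rewrite ltr_wpDl ?sqr_ge0// mulr_gt0.
set s := sinh _.
have s0 : 0 < s.
  rewrite divr_gt0// subr_gt0 ltr_expR (@lt_trans _ _ 0)//.
    by rewrite oppr_lt0 mulr_gt0// sqrtr_gt0.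
  by rewrite mulr_gt0// sqrtr_gt0.
have E2 : ('E_P[U * D])%E = (V c mu nu ^+ 2 / (2 * nu ^+ 2))%:E.
  by rewrite unlock -half -LL; exact: EUD.
split => //.
- rewrite covarianceE; [|exact/Lfun1_integrable..].
  rewrite E2 -half -LL.
  have -> : ('E_P[U])%E = (mean_limit c nu mu)%:E by rewrite unlock; exact: EU.
  have -> : ('E_P[D])%E = (mean_limit c nu (- mu))%:E by rewrite unlock; exact: ED.
  by rewrite -EFinM -EFinB; congr EFin; ring.
- rewrite /V -/s exprMn exprVn sqr_sqrtr ?(ltW q0)//.
  by field; rewrite !gt_eqF.
- by rewrite divr_gt0// mulr_gt0 ?exprn_gt0// mulr_gt0 ?exprn_gt0.
Qed.
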